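(* There is a minimal forbidden-sublattice family $\mathcal{F}$ for planarity of finite dismantlable semidistributive lattices (in the sense defined in the context) such that for every $F \in \mathcal{F}$ the following holds. Let $0$ be the bottom element and $1$ the top element of $F$. Then in $F$, $1$ covers two distinct elements $a$ and $b$, $0$ is covered by two distinct elements $c$ and $d$, and $c + d < ab$. Furthermore, there exist $a', b', c', d' \in F$ with the following properties: (1) $a' \neq ab$ and $a'$ is covered by $a$; $b' \neq ab$ and $b'$ is covered by $b$; $c' \neq c+d$ and $c'$ covers $c$; $d' \neq c+d$ and $d'$ covers $d$. (2) Either $|\{a',b',c',d'\}| = 4$, or $|\{a',b',c',d'\}| = 3$ with $a' \neq b'$ and $c' \neq d'$.
   Context: Join is written $+$ and meet is written as juxtaposition. A lattice is semidistributive if it satisfies both $(SD_\vee)$: $x = a+b = a+c$ implies $x = a + bc$, and $(SD_\wedge)$: $x = ab = ac$ implies $x = a(b+c)$. A finite lattice $L$ is dismantlable if its elements can be labelled $a_1, a_2, \dots, a_n$ so that $\{a_1\}, \{a_1,a_2\}, \dots, \{a_1,\dots,a_{n-1}\}$ are all sublattices of $L$. A finite lattice is planar if its Hasse diagram can be drawn in $\mathbb{R}^2$ (as a Hasse diagram, with line segments for the covering relations) in such a way that no two of the drawn line segments intersect (except at common endpoints). A minimal forbidden-sublattice family here means a set $\mathcal{F}$ of lattices (considered up to isomorphism) such that: (i) each member of $\mathcal{F}$ is a finite dismantlable semidistributive non-planar lattice; (ii) a finite dismantlable semidistributive lattice is planar if and only if it does not contain a member of $\mathcal{F}$ as a sublattice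 (up to isomorphism); (iii) $\mathcal{F}$ is minimal, i.e. no proper subset of $\mathcal{F}$ satisfies (ii) (equivalently, no member of $\mathcal{F}$ has a proper non-planar sublattice, and members are pairwise non-isomorphic). *)

(* Defs.v *)
From mathcomp Require Import all_boot all_order all_algebra.
From mathcomp Require Import classical_sets set_interval reals.

Set Implicit Arguments.
Unset Strict Implicit.
Unset Printing Implicit Defensive.

Import Order.Theory.

Local Open Scope order_scope.

Definition covby d (P : finPOrderType d) (x y : P) : bool :=
  (x < y) && [forall z, ~~ (x < z < y)].

Definition semidistributive d (L : latticeType d) : Prop :=
  (forall x a b c : L,
     x = a `|` b -> x = a `|` c -> x = a `|` (b `&` c)) /\
  (forall x a b c : L,
     x = a `&` b -> x = a `&` c -> x = a `&` (b `|` c)).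

Definition dismantlable d (L : finLatticeType d) : Prop :=
  exists s : seq L,
    [/\ uniq s, s =i predT &
        forall k, (0 < k < size s)%N ->
          meet_closed (mem (take k s)) /\
          join_closed (mem (take k s))].

Definition segment (R : realType) (p q : R * R) : set (R * R) :=
  [set (line_path p.1 q.1 t, line_path p.2 q.2 t) | t in `[0%R, 1%R]]%classic.

(* Injectivity and vertex avoidance belong to the usual notion of a Hasse
   diagram: only then do the drawn segments determine the covering relation. *)
Definition hasse_drawing (R : realType) d (P : finPOrderType d)
    (pos : P -> R * R) : Prop :=
  [/\ injective pos,
      forall x y, covby x y -> ((pos x).2 < (pos y).2)%R &
      forall x y z, covby x y -> segment (pos x) (pos y) (pos z) ->
        z = x \/ z = y].

Definition planar (R : realType) d (P : finPOrderType d) : Prop :=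
  exists2 pos : P -> R * R, hasse_drawing pos &
    forall x y u v, covby x y -> covby u v -> (x, y) <> (u, v) ->
    forall p, segment (pos x) (pos y) p -> segment (pos u) (pos v) p ->
      exists w, [/\ w \in [:: x; y], w \in [:: u; v] & p = pos w].

Definition embeds d (K : latticeType d) d' (L : latticeType d') : Prop :=
  exists f : {lmorphism K -> L}, injective f.

Definition isomorphic d (K : latticeType d) d' (L : latticeType d') : Prop :=
  exists f : {lmorphism K -> L}, bijective f.

(* The bounded finite lattices are exactly the nonempty ones.  Morphisms and
   sublattices are not required to preserve the bounds. *)
Definition lattice_class : Type := forall d, finTBLatticeType d -> Prop.

(* A set of lattices considered up to isomorphism is represented by the class
   of all lattices isomorphic to one of its members. *)
Definition iso_closed (F : lattice_class) : Prop :=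
  forall d (K : finTBLatticeType d) d' (L : finTBLatticeType d'),
    isomorphic K L -> F d K -> F d' L.

Definition characterizes_planarity (R : realType) (F : lattice_class) : Prop :=
  forall d (L : finTBLatticeType d),
    dismantlable L -> semidistributive L ->
    (planar R L <->
     ~ exists d' (K : finTBLatticeType d'), F d' K /\ embeds K L).

Record minimal_forbidden_family (R : realType) (F : lattice_class) : Prop :=
  MinimalForbiddenFamily {
    forbidden_iso_closed : iso_closed F;
    forbidden_members : forall d (L : finTBLatticeType d), F d L ->
      [/\ dismantlable L, semidistributive L & ~ planar R L];
    forbidden_characterizes : characterizes_planarity R F;
    forbidden_minimal : forall G : lattice_class, iso_closed G ->
      (forall d (L : finTBLatticeType d), G d L -> F d L) ->
      characterizes_planarity R G ->
      forall d (L : finTBLatticeType d), F d L -> G d L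
  }.

(* Main.v *)
(* A planar drawing determines, for incomparable x and y, whether x lies to the
   left of y, and this choice does not change when y slides along a chain of
   elements incomparable to x.  Conversely, in a dismantlable semidistributive
   lattice any choice of sides with this sliding property (an "orientation") is
   transitive, because there are no crowns, and yields two linear extensions
   realizing the order, hence a planar drawing.  Planarity is thus inherited by
   sublattices, and the family consists of the nonplanar lattices all of whose
   proper sublattices are planar.

   In such a lattice semidistributivity makes atoms join-prime and coatoms
   meet-prime, so L splits along the filters of its two atoms and the ideals of
   its two coatoms.  Whenever the configuration of the statement fails, this
   splitting lets one glue orientations of proper sublattices to one of L. *)
From HB Require Import structures.
From mathcomp Require Import classical_sets set_interval boolp topology normedtype.
Require Import Defs.
From mathcomp Require Import all_boot all_order all_algebra reals ring lra.

Set Implicit Arguments.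
Unset Strict Implicit.
Unset Printing Implicit Defensive.

Import Order.Theory GRing.Theory Num.Theory.

Local Open Scope order_scope.

(** The obstacle is that a sublattice has covers that need not be covers of the whole lattice, so
    erasing points from a drawing does not draw the sublattice. Orientations restrict to any subset
    at once; they replace drawings throughout, and geometry survives only in the two translations.
    In one direction the positions in two linear extensions serve as coordinates; in the other the
    intermediate value theorem turns a change of sides into a common vertex of two maximal chains.

    The combinatorial part uses a self-dual extract of minimality, so that each fact on coatoms is
    also one on atoms. Counting the four covers is then short: $a' \neq b'$ and $c' \neq d'$ hold
    anyway, so fewer than three elements means that both upper ones coincide with the two lower
    ones, and this leaves so rigid a lattice that any orientation of the interval $[c+d, ab]$
    extends to it. *)

(** * Incomparability, covers and orientations *)

Lemma inc_split d (P : porderType d) (x y : P) :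
  (x >< y) = ~~ (x <= y) && ~~ (y <= x).
Proof. by rewrite /Order.comparable negb_or. Qed.

Lemma inc_sym d (P : porderType d) (x y : P) : (x >< y) = (y >< x).
Proof. by rewrite comparable_sym. Qed.

Lemma covby_lt d (P : finPOrderType d) (x y : P) : covby x y -> x < y.
Proof. by case/andP. Qed.

Lemma covby_between d (P : finPOrderType d) (x y z : P) :
  covby x y -> x <= z -> z <= y -> z = x \/ z = y.
Proof.
case/andP=> _ /forallP /(_ z); rewrite !lt_def => H xz zy.
move: H; rewrite xz zy !andbT negb_and !negbK.
by case/orP=> /eqP; auto.
Qed.

Lemma ex_covby_below d (P : finPOrderType d) (x y : P) :
  x < y -> exists2 z, x <= z & covby z y.
Proof.
move=> xy; pose f z := #|[set w : P | w <= z]|.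
have Px : (x <= x < y) by rewrite lexx.
case: (@arg_maxnP _ x [pred z | x <= z < y] f Px) => z /andP[xz zy] zmax.
exists z => //; apply/andP; split=> //; apply/forallP=> w.
apply/negP=> /andP[zw wy].
have := zmax w; rewrite /= wy (le_trans xz (ltW zw)) => /(_ isT).
apply/negP; rewrite -ltnNge; apply/proper_card/properP; split.
  by apply/subsetP=> u; rewrite !inE => /le_trans; apply; apply: ltW.
by exists w; rewrite !inE ?lexx // lt_geF.
Qed.

Lemma covby_dual d (P : finPOrderType d) (x y : P) :
  @covby _ (P^d) x y = covby y x.
Proof.
rewrite /covby ltEdual; congr (_ && _).
by apply: eq_forallb => z; rewrite !ltEdual andbC.
Qed.

Lemma ex_covby_above d (P : finPOrderType d) (x y : P) :
  x < y -> exists2 z, covby x z & z <= y.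
Proof.
rewrite -ltEdual => /ex_covby_below[z]; rewrite leEdual covby_dual.
by exists z.
Qed.

(* An orientation says which of two incomparable elements is to the left;
   sliding one of them along a chain of elements incomparable to the other
   does not change sides. *)
Definition orientation d (L : porderType d) (S : {pred L}) (o : rel L) : Prop :=
  (forall x y, x \in S -> y \in S -> x >< y -> o x y = ~~ o y x) /\
  (forall x y z, x \in S -> y \in S -> z \in S ->
     x >< y -> x >< z -> y <= z -> o x y = o x z).

Definition orientable d (L : porderType d) (S : {pred L}) : Prop :=
  exists o, orientation S o.

Lemma orientation_flip d (L : porderType d) (S : {pred L}) o :
  orientation S o -> orientation S (fun x y => o y x).
Proof.
case=> anti slide; split=> [x y xS yS xy|x y z xS yS zS xy xz yz].
  by rewrite anti // inc_sym.
rewrite (anti y) 1?inc_sym // (anti z) 1?inc_sym //; congr (~~ _).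
exact: slide.
Qed.

(** Flipping all sides at once gives an orientation again, so one incomparable pair can be
    prescribed. This is the freedom used to match orientations of two pieces before gluing. *)
Lemma orientable_normal d (L : porderType d) (S : {pred L}) x0 y0 :
  orientable S -> exists2 o, orientation S o &
    x0 \in S -> y0 \in S -> x0 >< y0 -> o x0 y0.
Proof.
case=> o oS; case: (boolP (o x0 y0)) => oxy; first by exists o.
exists (fun x y => o y x); first exact: orientation_flip.
by move=> xS yS xy; have := oS.1 _ _ xS yS xy; rewrite (negbTE oxy); case: (o _ _).
Qed.

Lemma orientable_sub d (L : porderType d) (S T : {pred L}) :
  {subset T <= S} -> orientable S -> orientable T.
Proof.
move=> sTS [o [anti slide]]; exists o; split.
  by move=> x y /sTS xS /sTS yS; apply: anti.
by move=> x y z /sTS xS /sTS yS /sTS zS; apply: slide.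
Qed.

(** * Critical lattices *)

(** The order-theoretic content of minimal nonplanarity. Dismantlability is replaced by the absence
    of crowns formed by three elements and their pairwise meets or joins, which makes the notion
    self-dual. *)
Record critical d (L : finTBLatticeType d) : Prop := Critical {
  critical_sd : semidistributive L;
  critical_crown : forall x y z : L,
    [|| y `&` z <= x, x `&` z <= y | x `&` y <= z] /\
    [|| x <= y `|` z, y <= x `|` z | z <= x `|` y];
  critical_sub : forall S : {set L}, meet_closed (mem S) -> join_closed (mem S) ->
    S != setT -> orientable S;
  critical_not : ~ orientable (predT : {pred L})
}.

Lemma orientation_dual d (L : porderType d) (S : {pred L}) o :
  orientation S o -> @orientation _ (L^d) S o.
Proof.
case=> anti slide; split=> [x y xS yS xy|x y z xS yS zS xy xz yz].
  by apply: anti; rewrite // inc_sym.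
by symmetry; apply: slide=> //; rewrite inc_sym.
Qed.

Lemma critical_dual d (L : finTBLatticeType d) : critical L -> critical (L^d).
Proof.
case=> [[sdj sdm] cr sub nor]; split.
- by split=> x a b c; [apply: sdm | apply: sdj].
- by move=> x y z; have [] := cr x y z.
- move=> S mS jS /(sub S jS mS)[o oS]; exists o; exact: orientation_dual.
- case=> o oS; apply: nor; exists o; case: oS => anti slide; split=> [x y|x y z] xS yS.
    by move=> xy; apply: anti=> //; rewrite inc_sym.
  by move=> zS xy xz yz; symmetry; apply: slide=> //; rewrite inc_sym.
Qed.

Section Critical.

Variables (d : Order.disp_t) (L : finTBLatticeType d).
Hypothesis critL : critical L.

Let sdj := (critical_sd critL).1.

Lemma coatom_le (a x : L) : covby a \top -> a <= x -> x = a \/ x = \top.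
Proof. by move=> ca ax; apply: (covby_between ca ax); apply: lex1. Qed.

Lemma coatom_join (a x : L) : covby a \top -> ~~ (x <= a) -> a `|` x = \top.
Proof.
move=> ca xa; case: (coatom_le ca (leUl a x)) => // E.
by move: xa; rewrite -E leUr.
Qed.

(** If neither [x] nor [y] is below [a], both have join 1 with [a], and $SD_\vee$ gives $a + xy =
    1$; but $xy \le a$ would make this join [a]. *)
Lemma coatom_prime (a x y : L) :
  covby a \top -> (x `&` y <= a) = (x <= a) || (y <= a).
Proof.
move=> ca; apply/idP/idP; last first.
  by case/orP; apply: le_trans; [apply: leIl | apply: leIr].
move=> xya; apply/negPn/negP; rewrite negb_or => /andP[xa ya].
have := sdj (esym (coatom_join ca xa)) (esym (coatom_join ca ya)).
rewrite (join_l xya) => E; have := covby_lt ca.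
by rewrite -E ltxx.
Qed.

Lemma coatom_exists (x : L) : x != \top -> exists2 a, x <= a & covby a \top.
Proof. by move=> x1; apply: ex_covby_below; rewrite ltx1. Qed.

Definition coatom_pair (a b : L) : Prop :=
  [/\ a != b, covby a \top, covby b \top &
      forall x, x != \top -> (x <= a) || (x <= b)].

Definition atom_pair (c d : L) : Prop :=
  [/\ c != d, covby \bot c, covby \bot d &
      forall x, x != \bot -> (c <= x) || (d <= x)].

(** If the elements other than 1 were closed under joins, they would form an orientable proper
    sublattice, and its orientation would serve for L because 1 is comparable to everything. So two
    of them have join 1, and lie below different coatoms. *)
Lemma ex_coatom_pair : exists a b, coatom_pair a b.
Proof.
pose S := [set~ \top : L].
have mS : meet_closed (mem S).
  move=> x y; rewrite !inE => x1 _; apply: contra x1 => /eqP E.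
  by rewrite -le1x -E leIl.
case: (boolP [forall x in S, forall y in S, x `|` y \in S]) => [jS | ].
  case: (critical_not critL).
  have [o [anti slide]] : orientable S.
    apply: (critical_sub critL) => //.
      by move=> x y xS yS; move/forall_inP: jS => /(_ x xS) /forall_inP; apply.
    by apply/eqP/setP=> /(_ \top); rewrite !inE eqxx.
  have inS x y : x >< y -> x \in S /\ y \in S.
    rewrite inc_split !inE => /andP[xy yx].
    by split; [apply: contraNneq yx => -> | apply: contraNneq xy => ->]; exact: lex1.
  exists o; split=> [x y _ _ xy|x y z _ _ _ xy xz].
    by have [xS yS] := inS _ _ xy; apply: anti.
  have [xS yS] := inS _ _ xy; have [_ zS] := inS _ _ xz.
  exact: slide.
rewrite negb_forall_in => /existsP[x /andP[]]; rewrite !inE => x1.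
rewrite negb_forall_in => /existsP[y /andP[]]; rewrite !inE negbK => y1 /eqP xy1.
have [a xa ca] := coatom_exists x1; have [b yb cb] := coatom_exists y1.
have ab : a != b.
  apply/eqP=> E; have := lt_geF (covby_lt ca); rewrite -xy1 leUx xa E yb //.
exists a, b; split=> // z z1.
have [e ze ce] := coatom_exists z1.
have eqc (u v : L) : covby u \top -> covby v \top -> u <= v -> u = v.
  move=> cu cv uv; case: (coatom_le cu uv) => // E.
  by have := covby_lt cv; rewrite E ltxx.
(* Among three coatoms the crown condition and primeness put one below another, so two of them are
   equal. *)
have [/or3P + _] := critical_crown critL a b e.
rewrite !coatom_prime // => -[] /orP[] /eqc E.
- by case/eqP: ab; rewrite E.
- by rewrite -E // ze.
- by case/eqP: ab; apply: E.
- by rewrite -[b]E // ze orbT.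
- by rewrite E // ze.
- by rewrite [b]E // ze orbT.
Qed.

End Critical.

Lemma coatom_pairC d (L : finTBLatticeType d) (a b : L) :
  coatom_pair a b -> coatom_pair b a.
Proof. by case=> ab ca cb H; split=> // [|x /H]; rewrite 1?eq_sym // orbC. Qed.

Lemma atom_pairC d (L : finTBLatticeType d) (a b : L) :
  atom_pair a b -> atom_pair b a.
Proof. by case=> ab ca cb H; split=> // [|x /H]; rewrite 1?eq_sym // orbC. Qed.

Lemma coatom_pair_dual d (L : finTBLatticeType d) (a b : L) :
  @coatom_pair _ (L^d) a b <-> atom_pair a b.
Proof. by rewrite /coatom_pair /atom_pair !covby_dual. Qed.

Lemma atom_prime d (L : finTBLatticeType d) (c x y : L) :
  critical L -> covby \bot c -> (c <= x `|` y) = (c <= x) || (c <= y).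
Proof.
move=> /critical_dual critL; rewrite -covby_dual => cc.
exact: (coatom_prime critL x y cc).
Qed.

Lemma ex_atom_pair d (L : finTBLatticeType d) :
  critical L -> exists c e : L, atom_pair c e.
Proof.
by move/critical_dual/ex_coatom_pair=> [c [e /coatom_pair_dual]]; exists c, e.
Qed.

Lemma orientation_left d (L : porderType d) (S : {pred L}) o x y z :
  orientation S o -> x \in S -> y \in S -> z \in S ->
  y >< x -> z >< x -> y <= z -> o y x = o z x.
Proof.
move=> oS xS yS zS yx zx yz; have [_ slide] := orientation_flip oS.
by apply: (slide x y z); rewrite // inc_sym.
Qed.

Lemma inc_nbot d (L : bPOrderType d) (x y : L) : x >< y -> (x != \bot) * (y != \bot).
Proof.
rewrite inc_split => /andP[xy yx].
by split; [apply: contraNneq xy => -> | apply: contraNneq yx => ->]; exact: le0x.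
Qed.

Lemma inc_ntop d (L : tPOrderType d) (x y : L) : x >< y -> (x != \top) * (y != \top).
Proof.
rewrite inc_split => /andP[xy yx].
by split; [apply: contraNneq yx => -> | apply: contraNneq xy => ->]; exact: lex1.
Qed.

(** * Gluing along a partition: atoms below coatoms *)

Section Glue.

Variables (d : Order.disp_t) (L : finTBLatticeType d) (a b u v : L).
Hypotheses (critL : critical L) (ab : coatom_pair a b) (uv : atom_pair u v).

Let ca : covby a \top. Proof. by case: ab. Qed.
Let cb : covby b \top. Proof. by case: ab. Qed.
Let cu : covby \bot u. Proof. by case: uv. Qed.
Let cv : covby \bot v. Proof. by case: uv. Qed.

Lemma ge_atom (x y : L) : covby \bot x -> y <= x -> y = \bot \/ y = x.
Proof. by move=> cx yx; apply: (covby_between cx); rewrite ?le0x. Qed.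

Lemma interval_orientable (lo hi : L) :
  (lo != \bot) || (hi != \top) -> orientable [pred x | lo <= x <= hi].
Proof.
move=> prop; pose S := [set x | lo <= x <= hi].
apply: (@orientable_sub _ _ S); first by move=> x; rewrite !inE.
apply: (critical_sub critL).
- move=> x y; rewrite !inE => /andP[lx xh] /andP[ly yh].
  by rewrite lexI lx ly (le_trans _ xh) // leIl.
- move=> x y; rewrite !inE => /andP[lx xh] /andP[ly yh].
  by rewrite leUx xh yh (le_trans lx) // leUl.
- apply/eqP=> /setP E; have := E \bot; have := E \top.
  rewrite !inE lex1 le0x lex0 le1x /= andbT => /eqP h1 /eqP l0.
  by rewrite h1 l0 !eqxx in prop.
Qed.

Lemma coatom_inc : a >< b.
Proof.
have [nab _ _ _] := ab; rewrite inc_split; apply/andP; split; apply/negP.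
  case/(coatom_le ca)=> E; first by rewrite E eqxx in nab.
  by have := covby_lt cb; rewrite E ltxx.
case/(coatom_le cb)=> E; first by rewrite E eqxx in nab.
by have := covby_lt ca; rewrite E ltxx.
Qed.

Lemma atom_inc : u >< v.
Proof.
have [nuv _ _ _] := uv; rewrite inc_split; apply/andP; split; apply/negP.
  case/(ge_atom cv)=> E; last by rewrite E eqxx in nuv.
  by have := covby_lt cu; rewrite E ltxx.
case/(ge_atom cu)=> E; last by rewrite E eqxx in nuv.
by have := covby_lt cv; rewrite E ltxx.
Qed.

Lemma atom_meet (x : L) : x `&` u != \bot -> u <= x.
Proof.
move=> xu; case: (ge_atom cu (leIr u x)) => E; first by rewrite E eqxx in xu.
by rewrite -E leIl.
Qed.

(* Otherwise L is the disjoint union of the ideal below a and the filter above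
   u, and orientations of [0, b] and [v, 1] glue along that partition. *)
Lemma atom_le_coatom : u <= a.
Proof.
apply/negPn/negP=> nua.
(* If $x \not\le a$, then primeness and $u \not\le a$ give $xu \not\le a$; hence $xu \neq 0$ and the
   atom [u] is below [x]. *)
have part x : (x <= a) = ~~ (u <= x).
  apply/idP/idP => [xa|]; first by apply: contra nua => /le_trans; apply.
  apply: contraR => xa; apply: atom_meet; apply: contraNneq nua => xu0.
  by have := coatom_prime critL x u ca; rewrite xu0 le0x (negbTE xa) /= => <-.
have leb x : u <= x -> x != \top -> x <= b.
  move=> ux x1; have [_ _ _ /(_ x x1)] := ab; rewrite part ux //.
have gev x : ~~ (u <= x) -> x != \bot -> v <= x.
  by move=> ux x0; have [_ _ _ /(_ x x0)] := uv; rewrite (negbTE ux).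
pose B := [pred x : L | \bot <= x <= b]; pose V := [pred x : L | v <= x <= \top].
have inB x : x <= b -> x \in B by rewrite inE le0x.
have inV x : v <= x -> x \in V by rewrite inE lex1 andbT.
(* The glued relation will put the filter of [u] to the left of the ideal of [a]. Taking [u] left of
   [v] in $[0,b]$, and [b] left of [a] in $[v,1]$, adapts both pieces to that rule. *)
have [|o1 oS1 o1uv] := @orientable_normal _ L B u v.
  by apply: interval_orientable; rewrite (inc_ntop coatom_inc) orbT.
have [|o2 oS2 o2ba] := @orientable_normal _ L V b a.
  by apply: interval_orientable; rewrite (inc_nbot atom_inc).
have [anti1 slide1] := oS1; have [anti2 slide2] := oS2.
case: (critical_not critL).
exists (fun x y => if u <= x then (if u <= y then o1 x y else true)
                   else if u <= y then false else o2 x y).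
split=> [x y _ _ xy|x y z _ _ _ xy xz yz].
  have [x0 y0] := inc_nbot xy; have [x1 y1] := inc_ntop xy.
  case: ifPn => ux; case: ifPn => uy //.
    by apply: anti1; rewrite // inB ?leb.
  by apply: anti2; rewrite // inV ?gev.
have [x0 y0] := inc_nbot xy; have [x1 y1] := inc_ntop xy.
have [_ z0] := inc_nbot xz; have [_ z1] := inc_ntop xz.
case: (boolP (u <= y)) => uy.
  have uz := le_trans uy yz; rewrite uz; case: ifPn => // ux.
  by apply: slide1; rewrite // inB ?leb.
have vy := gev _ uy y0.
case: (boolP (u <= z)) => uz; last first.
  case: ifPn => // ux.
  by apply: slide2; rewrite // inV ?gev.
(* Only here does the slide cross the partition, from [y] in the ideal to [z] in the filter. The
   sides are carried to the normalized pairs: down to [u] and [v] if [x] is in the filter, up to [b]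
   and [a] otherwise. *)
have zb := leb _ uz z1; have yb := le_trans yz zb; have vb := le_trans vy yb.
have vz := le_trans vy yz.
case: ifPn => ux.
  have xb := leb _ ux x1.
  have uy' : u >< y.
    rewrite inc_split uy /=; apply/negP=> /(ge_atom cu)[] E.
      by rewrite E eqxx in y0.
    by rewrite E lexx in uy.
  have ub := le_trans ux xb.
  rewrite -(slide1 x y z) ?inB //.
  rewrite -(orientation_left oS1 (y := u)) ?inB //.
  rewrite -(slide1 u v y) ?atom_inc ?inB //.
  by apply/esym/o1uv; rewrite ?atom_inc ?inB.
have xa : x <= a by rewrite part.
have vx := gev _ ux x0; have va := le_trans vx xa.
have za : z >< a.
  rewrite inc_split part uz /=; apply/negP=> /(coatom_le ca)[] E.
    by rewrite E (negbTE nua) in uz.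
  by rewrite E eqxx in z1.
rewrite (slide2 x y z) ?inV // anti2 ?inV //.
rewrite (slide2 z x a) 1?inc_sym ?inV //; last by rewrite inc_sym.
rewrite (orientation_left oS2 (z := b)) ?inV // 1?inc_sym ?coatom_inc //.
by rewrite o2ba ?inV // inc_sym coatom_inc.
Qed.

End Glue.

(** All elements of the interval incomparable to [m] lie on one side of it: two of them are not
    below [a], by primeness neither is their meet, so the meet is still incomparable to [m] and both
    slide down to it. A flip then makes that side the right one. *)
Lemma meet_prime_normal d (L : finTBLatticeType d) (a m lo hi : L) :
  critical L -> covby a \top -> orientable [pred x : L | lo <= x <= hi] ->
  lo <= m <= hi -> m <= a -> (forall x, lo <= x <= hi -> x <= a -> x <= m) ->
  exists2 o, orientation [pred x : L | lo <= x <= hi] o &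
    forall x, lo <= x <= hi -> m >< x -> o m x.
Proof.
move=> critL ca oS mS ma am; pose S := [pred x : L | lo <= x <= hi].
case: (pickP [pred x | S x && (m >< x)]) => [x0 /andP[x0S mx0]|none]; last first.
  by case: oS => o oS; exists o => // x xS mx; move/(_ x): none; rewrite /= xS mx.
have [o oS' oP] := @orientable_normal _ _ S m x0 oS.
exists o => // x xS mx.
have nlea y : S y -> m >< y -> ~~ (y <= a).
  move=> yS; rewrite inc_split => /andP[_ ym]; apply: contra ym; exact: am.
have [_ slide] := oS'.
have xx0S : x `&` x0 \in S.
  case/andP: xS => lx xh; case/andP: x0S => lx0 _.
  by rewrite inE lexI lx lx0 /= (le_trans _ xh) // leIl.
have mxx0 : m >< x `&` x0.
  rewrite inc_split; apply/andP; split.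
    by move: mx; rewrite inc_split lexI negb_and => /andP[->].
  have : ~~ (x `&` x0 <= a) by rewrite coatom_prime // negb_or !nlea.
  by apply: contra => /le_trans; apply.
rewrite -(slide m (x `&` x0) x) ?leIl //.
by rewrite (slide m (x `&` x0) x0) ?leIr //; apply: oP.
Qed.

(** * The join of the atoms and the meet of the coatoms *)

Section Spine.

Variables (d : Order.disp_t) (L : finTBLatticeType d) (a b u v : L).
Hypotheses (critL : critical L) (ab : coatom_pair a b) (uv : atom_pair u v).

Let ca : covby a \top. Proof. by case: ab. Qed.
Let cb : covby b \top. Proof. by case: ab. Qed.
Let ua : u <= a. Proof. exact: (atom_le_coatom critL ab uv). Qed.
Let ub : u <= b. Proof. exact: (atom_le_coatom critL (coatom_pairC ab) uv). Qed.
Let va : v <= a. Proof. exact: (atom_le_coatom critL ab (atom_pairC uv)). Qed.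
Let vb : v <= b.
Proof. exact: (atom_le_coatom critL (coatom_pairC ab) (atom_pairC uv)). Qed.

Lemma joins_le_meets : u `|` v <= a `&` b.
Proof. by rewrite lexI !leUx ua ub va vb. Qed.

(* If u + v = ab =: m then, apart from 0 and 1, L is the union of the intervals
   [u, a] and [v, b], which meet only in m; put the first to the left of the
   second. *)
Lemma joins_neq_meets_aux :
  (forall x, (x <= a) || (v <= x)) -> (forall x, (x <= b) || (u <= x)) ->
  u `|` v != a `&` b.
Proof.
move=> av bu; apply/eqP=> mE; pose m := a `&` b.
have lem x : x <= a -> x <= b -> x <= m by move=> xa xb; rewrite lexI xa xb.
have gem x : u <= x -> v <= x -> m <= x by move=> ux vx; rewrite /m -mE leUx ux vx.
have ma : m <= a := leIl _ _.
have mb : m <= b := leIr _ _.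
have um : u <= m by rewrite lem.
have vm : v <= m by rewrite lem.
pose U x := u <= x <= a; pose V x := v <= x <= b.
have UV x : x != \bot -> x != \top -> U x || V x.
  move=> x0 x1; rewrite /U /V; have := av x; have := bu x.
  have [_ _ _ /(_ x x1)] := ab; have [_ _ _ /(_ x x0)] := uv.
  by case: (x <= a) => /=; case: (x <= b) => /=; case: (u <= x) => /=; case: (v <= x).
have [u0 v0] : (u != \bot) * (v != \bot) by apply: inc_nbot (atom_inc uv).
(* [m] is the largest element of $[v,b]$ below [a], and of $[u,a]$ below [b]. So it can be made
   leftmost in the first interval and, after a flip, rightmost in the second. *)
have [|||x /andP[vx xb] xa|o1 oV o1m] := @meet_prime_normal _ L a m v b critL ca.
- by apply: interval_orientable; rewrite ?v0.
- by rewrite vm mb.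
- exact: ma.
- exact: lem.
have [|||x /andP[ux xa] xb|o2' oU' o2'm] := @meet_prime_normal _ L b m u a critL cb.
- by apply: interval_orientable; rewrite ?u0.
- by rewrite um ma.
- exact: mb.
- exact: lem.
pose o2 x y := o2' y x; have oU : orientation U o2 by apply: orientation_flip.
have o2m x : U x -> x >< m -> o2 x m by rewrite inc_sym; apply: o2'm.
have [anti1 slide1] := oV; have [anti2 slide2] := oU.
have VUm x : U x -> V x -> x = m.
  case/andP=> ux xa /andP[vx xb]; apply/le_anti.
  by rewrite lem // gem.
(* A slide between the two intervals must pass through their common element [m], where the
   normalizations apply. *)
have mixed y z : U y || V y -> U z || V z -> (V y != V z) || (U y != U z) ->
    y <= z -> (y <= m) && (m <= z).
  move=> yUV zUV nUV yz.
  have {}yUV : U y && V z || V y && U z.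
    by move: yUV zUV nUV; case: (U y); case: (V y); case: (U z); case: (V z).
  case/orP: yUV => /andP[/andP[ly yh] /andP[lz zh]].
    by rewrite lem ?gem // ?(le_trans yz) // (le_trans ly).
  by rewrite lem ?gem // ?(le_trans yz) // (le_trans ly).
have mixed_inc x y z : x >< y -> x >< z -> (y <= m) && (m <= z) -> x >< m.
  rewrite !inc_split => /andP[_ yx] /andP[xz _] /andP[ym mz].
  apply/andP; split; first by apply: contra xz => /le_trans; apply.
  by apply: contra yx; apply: le_trans.
pose o x y := if V x && V y then o1 x y else if U x && U y then o2 x y else U x.
have oVE x y : V x -> U y || V y -> x >< y -> o x y = V y && o1 x y.
  move=> xV yUV xy; rewrite /o xV /=; move: yUV; case: (V y) => //=.
  rewrite orbF => yU; rewrite yU andbT; case: (boolP (U x)) => //= xU.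
  have xm := VUm _ xU xV.
  by rewrite anti2 // xm o2m // -xm inc_sym.
have oUE x y : U x || V x -> ~~ V x -> o x y = (U y ==> o2 x y).
  by rewrite /o => + xV; rewrite (negbTE xV) orbF /= => xU; rewrite xU; case: (U y).
case: (critical_not critL); exists o.
split=> [x y _ _ xy|x y z _ _ _ xy xz yz].
  have [x0 y0] := inc_nbot xy; have [x1 y1] := inc_ntop xy.
  rewrite /o ![V y && _]andbC ![U y && _]andbC.
  case: ifP => xyV.
    by case/andP: xyV => xV yV; apply: anti1.
  case: ifP => xyU.
    by case/andP: xyU => xU yU; apply: anti2.
  move: xyV xyU (UV x x0 x1) (UV y y0 y1).
  by case: (U x); case: (V x); case: (U y); case: (V y).
have [x0 y0] := inc_nbot xy; have [x1 y1] := inc_ntop xy.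
have [_ z0] := inc_nbot xz; have [_ z1] := inc_ntop xz.
have xUV := UV x x0 x1; have yUV := UV y y0 y1; have zUV := UV z z0 z1.
case: (boolP ((V y != V z) || (U y != U z))) => [mix|]; last first.
  rewrite negb_or !negbK => /andP[/eqP Vyz /eqP Uyz].
  case: (boolP (V x)) => xV.
    rewrite !oVE // Vyz.
    by case: (boolP (V z)) => //= zV; apply: slide1 => //; change (is_true (V y)); rewrite Vyz.
  have xU : U x by rewrite (negbTE xV) orbF in xUV.
  rewrite !oUE // Uyz.
  by case: (boolP (U z)) => //= zU; apply: slide2 => //; change (is_true (U y)); rewrite Uyz.
have ymz := mixed y z yUV zUV mix yz; have xm := mixed_inc x y z xy xz ymz.
have [ym mz] := andP ymz.
have mV : V m by rewrite /V vm mb.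
have mU : U m by rewrite /U um ma.
case: (boolP (V x)) => xV.
  have xm0 : o1 x m = false by rewrite anti1 // o1m // inc_sym.
  rewrite !oVE //; case: (boolP (V y)) => yV /=; case: (boolP (V z)) => zV //=.
  - by rewrite (slide1 x y m) // xm0 -(slide1 x m z).
  - by rewrite (slide1 x y m) // xm0.
  - by rewrite -(slide1 x m z) // xm0.
have xU : U x by rewrite (negbTE xV) orbF in xUV.
have xm1 := o2m x xU xm.
rewrite !oUE //; case: (boolP (U y)) => yU /=; case: (boolP (U z)) => zU //=.
- by rewrite (slide2 x y m) // xm1 -(slide2 x m z).
- by rewrite (slide2 x y m) // xm1.
- by rewrite -(slide2 x m z) // xm1.
Qed.

(** A coatom and an atom determine a corner: the elements neither below the one nor above the other.
    An inhabitant [x0] of the corner of [a] and [v] empties both adjacent corners: its meet with an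
    element of the corner of [a] and [u] would be nonzero but above no atom, its join with one of
    the corner of [b] and [v] would differ from 1 but be below no coatom. *)
Lemma flap_opposite x0 : ~~ (x0 <= a) -> ~~ (v <= x0) ->
  (forall x, (x <= a) || (u <= x)) /\ (forall x, (x <= b) || (v <= x)).
Proof.
move=> x0a vx0; split=> x; apply: contraT; rewrite negb_or => /andP[xh lx].
  have : x0 `&` x != \bot.
    have : ~~ (x0 `&` x <= a) by rewrite coatom_prime // negb_or x0a.
    by apply: contraNneq => ->; exact: le0x.
  have [_ _ _ H] := uv; move=> /H /orP[] h.
    by rewrite (le_trans h (leIr _ _)) in lx.
  by rewrite (le_trans h (leIl _ _)) in vx0.
have nv : ~~ (v <= x0 `|` x) by rewrite (atom_prime x0 x critL) ?negb_or ?vx0 //; case: uv.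
have : x0 `|` x != \top by apply: contraNneq nv => ->; exact: lex1.
have [_ _ _ H] := ab; move=> /H /orP[] h.
  by rewrite (le_trans (leUl _ _) h) in x0a.
by rewrite (le_trans (leUr _ _) h) in xh.
Qed.

(* If every lower cover of a is ab, then a only has to be kept on the same side
   of the filter generated by h. *)
Lemma ex_other_lower_cover : exists2 a', a' != a `&` b & covby a' a.
Proof.
pose q := a `&` b.
case: (pickP [pred a' | (a' != q) && covby a' a]) => [a' /andP[]|none].
  by exists a'.
have ltq x : x < a -> x <= q.
  move=> /ex_covby_below[z xz za]; move/(_ z): none => /=.
  by rewrite za andbT => /eqP <-.
have [_ _ _ cov] := ab.
have nab : ~~ (a <= b) by move: (coatom_inc ab); rewrite inc_split => /andP[].
have a1 : a != \top by rewrite -ltx1 covby_lt.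
(* Without another lower cover [a] is doubly irreducible, so removing it leaves a sublattice. *)
pose S := [set~ a].
have [o oS] : orientable S.
  apply: (critical_sub critL).
  - move=> x y; rewrite !inE => xa ya; apply/eqP=> E.
    have ax : a <= x by rewrite -E leIl.
    have ay : a <= y by rewrite -E leIr.
    case: (coatom_le ca ax) => [Ex|Ex]; first by rewrite Ex eqxx in xa.
    case: (coatom_le ca ay) => [Ey|Ey]; first by rewrite Ey eqxx in ya.
    by rewrite -E Ex Ey meetxx eqxx in a1.
  - move=> x y; rewrite !inE => xa ya; apply/eqP=> E.
    have xq : x <= q by rewrite ltq // lt_def eq_sym xa -E leUl.
    have yq : y <= q by rewrite ltq // lt_def eq_sym ya -E leUr.
    have : a <= q by rewrite -E leUx xq yq.
    by rewrite lexI (negbTE nab) andbF.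
  - by apply/eqP=> /setP/(_ a); rewrite !inE eqxx.
have [anti slide] := oS.
(* By primeness this meet is itself not below [a], hence the least such element. *)
pose h := \meet_(x | ~~ (x <= a)) x.
have ha : ~~ (h <= a).
  rewrite /h; elim/big_ind: _ => //.
    by rewrite le1x.
  by move=> x y xa ya; rewrite coatom_prime // negb_or xa.
have hle x : ~~ (x <= a) -> h <= x by move=> xa; apply: meets_inf.
have inS x : x != a -> x \in S by rewrite !inE.
have qa : q != a by apply: contraNneq nab => <-; exact: leIr.
have hna : h != a by apply: contraNneq ha => ->.
case: (critical_not critL).
(* [a] takes over the side that [q] has relative to [h]: a slide from below up to [a] passes through
   [q], and any [x] incomparable to [a] slides down to [h]. If [q] and [h] are comparable, no slide
   reaches [a] and the choice is free. *)
exists (fun x y => if x == a then o q h else if y == a then ~~ o q h else o x y).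
split=> [x y _ _ xy|x y z _ _ _ xy xz yz].
  case: eqVneq => xa; case: eqVneq => ya //.
  - by rewrite xa ya comparablexx in xy.
  - by rewrite negbK.
  - by apply: anti; rewrite ?inS.
case: eqVneq => xa //; case: (eqVneq y a) => ya.
  case: eqVneq => za //; rewrite ya in yz.
  case: (coatom_le ca yz) => E; first by rewrite E eqxx in za.
  by have := (inc_ntop xz).2; rewrite E eqxx.
case: eqVneq => za; last by apply: slide; rewrite ?inS.
rewrite za in xz yz; have yq : y <= q by rewrite ltq // lt_def eq_sym ya.
move: (xz); rewrite inc_split => /andP[xna _].
have qx : q >< x.
  move: xy; rewrite !inc_split => /andP[_ yx]; apply/andP; split.
    by apply: contra yx; apply: le_trans.
  by apply: contra xna => /le_trans; apply; apply: leIl.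
have hx := hle _ xna.
have qh : q >< h.
  move: qx; rewrite !inc_split => /andP[qx _]; apply/andP; split.
    by apply: contra qx => /le_trans; apply.
  by apply: contra ha => /le_trans; apply; apply: leIl.
rewrite anti ?inS //; congr (~~ _).
by rewrite (orientation_left oS (z := q)) ?inS // 1?inc_sym // (slide q h x) ?inS.
Qed.

End Spine.

(** At most two opposite corners are inhabited, by [flap_opposite]; up to exchanging the atoms this
    is the hypothesis of [joins_neq_meets_aux]. *)
Lemma joins_neq_meets d (L : finTBLatticeType d) (a b u v : L) :
  critical L -> coatom_pair a b -> atom_pair u v -> u `|` v != a `&` b.
Proof.
move=> critL ab uv; apply/eqP=> E; have vu := atom_pairC uv; have ba := coatom_pairC ab.
have opp : (forall x, (x <= a) || (u <= x)) -> (forall x, (x <= b) || (v <= x)) -> False.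
  move=> au bv; have := joins_neq_meets_aux critL ab vu au bv.
  by rewrite joinC E eqxx.
have av x : (x <= a) || (v <= x).
  by apply: contraT; rewrite negb_or => /andP[xa vx]; have [/opp] := flap_opposite critL ab uv xa vx.
have bu x : (x <= b) || (u <= x).
  apply: contraT; rewrite negb_or => /andP[xa vx].
  by have [bv /opp] := flap_opposite critL ba vu xa vx.
by have := joins_neq_meets_aux critL ab uv av bu; rewrite E eqxx.
Qed.

(** * Elements covering an atom and covered by a coatom *)

Section DoubleFlap.

Variables (d : Order.disp_t) (L : finTBLatticeType d) (a b u v e : L).
Hypotheses (critL : critical L) (ab : coatom_pair a b) (uv : atom_pair u v).
Hypotheses (ue : covby u e) (ea : covby e a).
Hypotheses (neb : ~~ (e <= b)) (nve : ~~ (v <= e)).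

Let ca : covby a \top. Proof. by case: ab. Qed.
Let cb : covby b \top. Proof. by case: ab. Qed.
Let cu : covby \bot u. Proof. by case: uv. Qed.
Let cv : covby \bot v. Proof. by case: uv. Qed.
Let ub : u <= b. Proof. exact: (atom_le_coatom critL (coatom_pairC ab) uv). Qed.
Let va : v <= a. Proof. exact: (atom_le_coatom critL ab (atom_pairC uv)). Qed.

(** The join of [x] with [e] stays in the corner of [b] and [v], since [v] is join-prime. It differs
    from 1, so it lies between [e] and [a], and it is not [a], which is above [v]. Hence $x \le e$,
    and dually $e \le x$. *)
Lemma flap_unique x : ~~ (x <= b) -> ~~ (v <= x) -> x = e.
Proof.
move=> xb vx; apply/le_anti/andP; split.
  have nv : ~~ (v <= x `|` e) by rewrite (atom_prime x e critL) ?negb_or ?vx.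
  have : x `|` e != \top by apply: contraNneq nv => ->; exact: lex1.
  have [_ _ _ H] := ab; move=> /H /orP[] h; last first.
    by rewrite (le_trans (leUl _ _) h) in xb.
  case: (covby_between ea (leUr _ _) h) => E; first by rewrite -E leUl.
  by rewrite E va in nv.
have nb : ~~ (x `&` e <= b) by rewrite (coatom_prime critL) ?negb_or ?xb.
have : x `&` e != \bot by apply: contraNneq nb => ->; exact: le0x.
have [_ _ _ H] := uv; move=> /H /orP[] h; last first.
  by rewrite (le_trans h (leIl _ _)) in vx.
case: (covby_between ue h (leIr _ _)) => E; last by rewrite -E leIl.
by rewrite E ub in nb.
Qed.

(** Joining [x] with [e] gives an element of the corner, which is [e] by uniqueness; so a nonzero
    [x] lies between [u] and [e]. *)
Lemma flap_below x : ~~ (v <= x) -> [\/ x = \bot, x = u | x = e].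
Proof.
move=> vx; case: (eqVneq x \bot) => [|x0]; first by constructor 1.
have [_ _ _ /(_ x x0)] := uv; rewrite (negbTE vx) orbF => ux.
have xe : x <= e.
  rewrite -[leRHS](@flap_unique (x `|` e)) ?leUl //.
    by rewrite leUx negb_and neb orbT.
  by rewrite (atom_prime x e critL) // negb_or vx.
by case: (covby_between ue ux xe) => ->; [constructor 2 | constructor 3].
Qed.

Lemma flap_above x : ~~ (x <= b) -> [\/ x = \top, x = a | x = e].
Proof.
move=> xb; case: (eqVneq x \top) => [|x1]; first by constructor 1.
have [_ _ _ /(_ x x1)] := ab; rewrite (negbTE xb) orbF => xa.
have xe : e <= x.
  rewrite -[leLHS](@flap_unique (x `&` e)) ?leIl //.
    by rewrite (coatom_prime critL) // negb_or xb.
  by rewrite lexI negb_and nve orbT.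
by case: (covby_between ea xe xa) => ->; [constructor 3 | constructor 2].
Qed.

End DoubleFlap.

Section TwoDoubleFlaps.

Variables (d : Order.disp_t) (L : finTBLatticeType d) (a b u v e f : L).
Hypotheses (critL : critical L) (ab : coatom_pair a b) (uv : atom_pair u v).
Hypotheses (ue : covby u e) (ea : covby e a) (vf : covby v f) (fb : covby f b).
Hypotheses (em : e != a `&` b) (fm : f != a `&` b).
Hypotheses (ep : e != u `|` v) (fp : f != u `|` v).

(* Then L consists of 0, u, v, the interval [u + v, ab], a, b, 1 and the two
   elements e and f, so an orientation of the interval extends to L. *)
Lemma no_two_double_flaps : False.
Proof.
have ba := coatom_pairC ab; have vu := atom_pairC uv.
have neb : ~~ (e <= b).
  apply: contra em => eb; have eam : e <= a `&` b by rewrite lexI eb ltW ?covby_lt.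
  case: (covby_between ea eam (leIl _ _)) => [->//|E].
  by move: (coatom_inc ab); rewrite inc_split -leIidl E lexx.
have nfa : ~~ (f <= a).
  apply: contra fm => fa; have fam : f <= a `&` b by rewrite lexI fa ltW ?covby_lt.
  case: (covby_between fb fam (leIr _ _)) => [->//|E].
  by move: (coatom_inc ab); rewrite inc_split -(leIidl b a) meetC E lexx andbF.
have nve : ~~ (v <= e).
  apply: contra ep => ve; have uve : u `|` v <= e by rewrite leUx ve ltW ?covby_lt.
  case: (covby_between ue (leUl _ _) uve) => [E|->//].
  by move: (atom_inc uv); rewrite inc_split -(leUidr v u) E lexx andbF.
have nuf : ~~ (u <= f).
  apply: contra fp => uf; have uvf : u `|` v <= f by rewrite leUx uf ltW ?covby_lt.
  case: (covby_between vf (leUr _ _) uvf) => [E|->//].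
  by move: (atom_inc uv); rewrite inc_split -(leUidl u v) E lexx.
have belowe := flap_below critL ab uv ue ea neb nve.
have belowf := flap_below critL ba vu vf fb nfa nuf.
have abovee := flap_above critL ab uv ue ea neb nve.
have abovef := flap_above critL ba vu vf fb nfa nuf.
have [o oS] : orientable [pred x | u `|` v <= x <= a `&` b].
  apply: interval_orientable => //.
  have := inc_nbot (atom_inc uv); rewrite -!lt0x => -[u0 _].
  by rewrite (lt_le_trans u0) // leUl.
have [anti slide] := oS.
have [le_ua le_vb] : u <= a /\ v <= b.
  by split; [exact: atom_le_coatom critL ab uv | exact: atom_le_coatom critL ba vu].
(* The chain $u < e < a$ goes to the far left and $v < f < b$ to the far right of the interval. *)
pose l x := x \in [:: u; e; a]; pose r x := x \in [:: v; f; b].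
have [ue' ea' vf' fb'] : [/\ u <= e, e <= a, v <= f & f <= b].
  by rewrite !ltW ?covby_lt.
have chain (s t w x y : L) : s <= t -> t <= w -> x \in [:: s; t; w] ->
    y \in [:: s; t; w] -> ~~ (x >< y).
  move=> st tw; have sw := le_trans st tw.
  by rewrite !inE => /or3P[]/eqP-> /or3P[]/eqP->; rewrite inc_split ?lexx ?st ?tw ?sw ?andbF.
have ll x y : l x -> l y -> ~~ (x >< y) by apply: chain.
have rr x y : r x -> r y -> ~~ (x >< y) by apply: chain.
have mid x y : x >< y -> ~~ l x -> ~~ r x -> u `|` v <= x <= a `&` b.
  move=> xy; have [x0 _] := inc_nbot xy; have [x1 _] := inc_ntop xy.
  rewrite /l /r !inE !negb_or => /and3P[xu xe xa] /and3P[xv xf xb].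
  rewrite leUx lexI -!andbA; apply/and4P; split; apply: contraT.
  - by case/belowf=> E; move: x0 xv xf; rewrite E eqxx.
  - by case/belowe=> E; move: x0 xu xe; rewrite E eqxx.
  - by case/abovef=> E; move: x1 xf xb; rewrite E eqxx.
  - by case/abovee=> E; move: x1 xe xa; rewrite E eqxx.
have mid_inc x y : u `|` v <= x <= a `&` b -> x >< y ->
    [&& y != \bot, y != \top, y != a, y != b, y != u & y != v].
  rewrite leUx lexI => /andP[/andP[ux vx] /andP[xa xb]] xy.
  rewrite (inc_nbot xy) (inc_ntop xy) /=; move: xy; rewrite inc_split.
  by do ![case: eqVneq => [->|_]; rewrite ?ux ?vx ?xa ?xb ?andbF //].
(* An element of the interval is comparable to the ends of both chains, so only [e] and [f] matter
   there. What lies above or below them is on their own chain or is a bound, so no proper slide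
   enters or leaves them. *)
have flap_stuck x y z : u `|` v <= x <= a `&` b -> x >< y -> x >< z -> y <= z ->
    [|| l y, r y, l z | r z] -> y = z.
  move=> xm /(mid_inc _ _ xm)/and5P[y0 y1 ya yb /andP[yu yv]].
  move=> /(mid_inc _ _ xm)/and5P[z0 z1 za zb /andP[zu zv]] yz.
  rewrite /l /r !inE.
  rewrite (negbTE ya) (negbTE yb) (negbTE yu) (negbTE yv).
  rewrite (negbTE za) (negbTE zb) (negbTE zu) (negbTE zv) /= !orbF.
  case/or4P=> /eqP E.
  - have zb' : ~~ (z <= b) by apply: contra neb; rewrite -E; apply: le_trans.
    case: (abovee z zb') => Ez.
    + by rewrite Ez eqxx in z1.
    + by rewrite Ez eqxx in za.
    + by rewrite E Ez.
  - have za' : ~~ (z <= a) by apply: contra nfa; rewrite -E; apply: le_trans.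
    case: (abovef z za') => Ez.
    + by rewrite Ez eqxx in z1.
    + by rewrite Ez eqxx in zb.
    + by rewrite E Ez.
  - have vy : ~~ (v <= y) by apply: contra nve => /le_trans; apply; rewrite -E.
    case: (belowe y vy) => Ez.
    + by rewrite Ez eqxx in y0.
    + by rewrite Ez eqxx in yu.
    + by rewrite E Ez.
  - have uy : ~~ (u <= y) by apply: contra nuf => /le_trans; apply; rewrite -E.
    case: (belowf y uy) => Ez.
    + by rewrite Ez eqxx in y0.
    + by rewrite Ez eqxx in yv.
    + by rewrite E Ez.
case: (critical_not critL).
exists (fun x y => if l x then true else if l y then false else
                   if r y then true else if r x then false else o x y).
split=> [x y _ _ xy|x y z _ _ _ xy xz yz].
  have yx : y >< x by rewrite inc_sym.
  case: ifPn => lx; first by rewrite (contraTF (ll x y lx)).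
  case: ifPn => // ly; case: ifPn => ry.
    by rewrite (contraTF (rr y x ry)).
  by case: ifPn => // rx; apply: anti => //; rewrite inE; apply: mid; eassumption.
case: ifPn => lx //; case: (boolP (r x)) => rx.
  rewrite (contraTF (rr x y rx)) // (contraTF (rr x z rx)) //.
  by case: (l y); case: (l z).
have xm := mid x y xy lx rx.
case: (boolP [|| l y, r y, l z | r z]) => [/(flap_stuck x y z xm xy xz yz) -> //|].
case/norP=> ly /norP[ry /norP[lz rz]].
rewrite (negbTE ly) (negbTE ry) (negbTE lz) (negbTE rz).
apply: slide => //; rewrite inE.
  by apply: (mid y x); rewrite // inc_sym.
by apply: (mid z x); rewrite // inc_sym.
Qed.

End TwoDoubleFlaps.

(** * Counting the four covers *)

Lemma card_set4 (T : finType) (x y z t : T) :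
  #|[set x; y; z; t]| = size (undup [:: x; y; z; t]).
Proof.
rewrite -(card_uniqP (undup_uniq _)); apply: eq_card => w.
by rewrite mem_undup !inE -!orbA.
Qed.

(** A common lower cover of both coatoms could only be their meet, so $a' \neq b'$, and dually for
    the atoms. Fewer than three elements would thus match the two pairs, straight or crossed, and
    [no_two_double_flaps] excludes both. *)
Lemma critical_covers d (L : finTBLatticeType d) : critical L ->
  exists a b c e : L,
    [/\ a != b /\ c != e,
        covby a \top /\ covby b \top,
        covby \bot c /\ covby \bot e,
        c `|` e < a `&` b &
        exists a' b' c' e' : L,
          [/\ a' != a `&` b /\ covby a' a,
              b' != a `&` b /\ covby b' b,
              c' != c `|` e /\ covby c c',
              e' != c `|` e /\ covby e e' &
              #|[set a'; b'; c'; e']| = 4 \/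
              [/\ #|[set a'; b'; c'; e']| = 3, a' != b' & c' != e']]].
Proof.
move=> critL; have critD := critical_dual critL.
have [a [b ab]] := ex_coatom_pair critL; have [u [v uv]] := ex_atom_pair critL.
have ba := coatom_pairC ab; have vu := atom_pairC uv.
have /coatom_pair_dual uvD := uv.
have vuD := coatom_pairC uvD.
have [a' a'm a'a] := ex_other_lower_cover critL ab.
have [b' b'm b'b] := ex_other_lower_cover critL ba; rewrite meetC in b'm.
have [u' u'm u'u] := ex_other_lower_cover critD uvD; rewrite covby_dual in u'u.
have [v' v'm v'v] := ex_other_lower_cover critD vuD; rewrite covby_dual in v'v.
have {}u'm : u' != u `|` v := u'm; have {}v'm : v' != v `|` u := v'm.
rewrite joinC in v'm.
have ne : a' != b'.
  apply: contra a'm => /eqP E; have ma : a' <= a `&` b.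
    by rewrite lexI {2}E !ltW ?covby_lt.
  case: (covby_between a'a ma (leIl _ _)) => [->//|E'].
  by move: (coatom_inc ab); rewrite inc_split -leIidl E' lexx.
have ne' : u' != v'.
  apply: contra u'm => /eqP E; have mu : u `|` v <= u'.
    by rewrite leUx {2}E !ltW ?covby_lt.
  case: (covby_between u'u (leUl _ _) mu) => [E'|->//].
  by move: (atom_inc uv); rewrite inc_split -(leUidr v u) E' lexx andbF.
have parallel : a' = u' -> b' = v' -> False.
  move=> E1 E2; subst u' v'.
  exact: (no_two_double_flaps critL ab uv u'u a'a v'v b'b).
have crossed : a' = v' -> b' = u' -> False.
  move=> E1 E2; subst u' v'.
  by apply: (no_two_double_flaps critL ab vu v'v a'a u'u b'b); rewrite // joinC.
case: (ab) (uv) => nab ca cb _ [nuv cu cv _].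
exists a, b, u, v; split=> //.
  by rewrite lt_neqAle (joins_neq_meets critL ab uv) (joins_le_meets critL ab uv).
exists a', b', u', v'; split=> //.
suff : (2 < #|[set a'; b'; u'; v']|)%N.
  have : (#|[set a'; b'; u'; v']| <= 4)%N by rewrite card_set4 size_undup.
  by case: #|_| => [|[|[|[|[|n]]]]] // _ _; [right | left].
rewrite card_set4 /= !inE (negbTE ne) (negbTE ne') /=.
case: (eqVneq a' u') => [E1|_]; case: (eqVneq a' v') => [E2|_];
  case: (eqVneq b' u') => [E3|_]; case: (eqVneq b' v') => [E4|_] //=;
  first [ by case: (parallel E1 E4) | by case: (crossed E2 E3)
     | by rewrite -E1 -E2 eqxx in ne' | by rewrite -E3 -E4 eqxx in ne'
     | by rewrite E1 -E3 eqxx in ne | by rewrite E2 -E4 eqxx in ne ].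
Qed.

(** * From orientations to drawings *)

Lemma ord3_third (i j : 'I_3) : i != j -> exists2 k, k != i & k != j.
Proof.
move=> _; case: (pickP [pred k | (k != i) && (k != j)]) => [k /andP[]|none].
  by exists k.
have : (#|'I_3| <= #|[set i; j]|)%N.
  rewrite -cardsT; apply/subset_leq_card/subsetP=> k _.
  by move/(_ k): none; rewrite !inE /=; do 2!case: (_ == _).
by rewrite card_ord cards2; case: (_ == _).
Qed.

Lemma ord3_other (i j : 'I_3) : i != j -> (i = j + 1 \/ i = j + 2)%R.
Proof.
case: i => [[|[|[|//]]]] ?; case: j => [[|[|[|//]]]] ? //= _;
  by [left; apply/val_inj | right; apply/val_inj].
Qed.

Lemma ord3_succ (j : 'I_3) : ((j + 1 != j) && (j + 2 != j))%R.
Proof. by case: j => [[|[|[|//]]]] ?. Qed.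

(* Along a dismantling sequence the last element of a crown is doubly
   irreducible, hence replaceable: the three joins (or meets) of the other side
   are available earlier. *)
Lemma dismantlable_no_crown d (L : finTBLatticeType d) (x y : 'I_3 -> L) :
  dismantlable L -> ~ (forall i j, (y i <= x j) = (i != j)).
Proof.
case=> s [us sT closed]; have xs i : x i \in take (size s) s by rewrite take_size sT.
have ys i : y i \in take (size s) s by rewrite take_size sT.
(* Induction on the length of a prefix of [s] containing the whole crown. *)
move: (leqnn (size s)) x y xs ys; move: {1 3 4}(size s) => k.
elim: k => [|k IH] ks x y xs ys xy; first by have := xs ord0; rewrite take0.
rewrite (take_nth (x ord0)) // in xs ys; set z := nth _ s k in xs ys.
have disj i j : x i != y j.
  apply/eqP=> E; case: (eqVneq j i) => [ji|ji].
    by move: (xy j i); rewrite E lexx ji eqxx.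
  have [l lj li] := ord3_third ji.
  have := xy l l; rewrite eqxx => /negbT/negP; apply.
  by apply: (@le_trans _ _ (x i)); rewrite ?xy // E xy eq_sym.
have sub (f : 'I_3 -> L) : (forall i, f i != z) ->
    (forall i, f i \in rcons (take k s) z) -> forall i, f i \in take k s.
  by move=> fz fs i; have := fs i; rewrite mem_rcons inE (negbTE (fz i)).
have clk (w : L) : w \in take k s ->
    meet_closed (mem (take k s)) /\ join_closed (mem (take k s)).
  move=> wk; apply: closed; rewrite ks andbT.
  by case: (k) wk => //; rewrite take0.
case: (pickP (fun i => y i == z)) => [i0 /eqP yz|yz].
  have xk : forall i, x i \in take k s.
    by apply: sub => // i; rewrite -yz.
  have [mk _] := clk _ (xk ord0).
  (* Addition is modulo 3, so these are the two indices other than [i]. The new elements still form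
     a crown with [x]: the old [y j] is below the new one, which is therefore not below [x j]. *)
  apply: (IH (ltnW ks) x (fun i => x (i + 1)%R `&` x (i + 2)%R)) => // [i|i j].
    exact: mk.
  case: (eqVneq i j) => [->|ij].
    have nyx : ~~ (y j <= x j) by rewrite xy eqxx.
    apply/negbTE; apply: contra nyx; apply: le_trans.
    by have /andP[] := ord3_succ j; rewrite lexI !xy ![j == _]eq_sym => -> ->.
  by rewrite eq_sym in ij; have [->|->] := ord3_other ij; rewrite ?leIl ?leIr.
have yk : forall i, y i \in take k s by apply: sub => // i; rewrite yz.
have [_ jk] := clk _ (yk ord0).
apply: (IH (ltnW ks) (fun i => y (i + 1)%R `|` y (i + 2)%R) y) => // [i|i j].
  exact: jk.
case: (eqVneq i j) => [->|ij].
  have nyx : ~~ (y j <= x j) by rewrite xy eqxx.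
  apply/negbTE; apply: contra nyx => /le_trans; apply.
  by have /andP[] := ord3_succ j; rewrite leUx !xy => -> ->.
by have [->|->] := ord3_other ij; rewrite ?leUl ?leUr.
Qed.

Lemma dismantlable_crown d (L : finTBLatticeType d) (x y z : L) :
  dismantlable L ->
  [|| y `&` z <= x, x `&` z <= y | x `&` y <= z] /\
  [|| x <= y `|` z, y <= x `|` z | z <= x `|` y].
Proof.
move=> disL; pose f (i : 'I_3) := nth \bot [:: x; y; z] i.
split; apply: contraT; rewrite !negb_or => /and3P[h0 h1 h2]; exfalso.
  pose g (i : 'I_3) := nth \bot [:: y `&` z; x `&` z; x `&` y] i.
  apply: (@dismantlable_no_crown _ L f g disL) => i j.
  case: i => [[|[|[|//]]]] ?; case: j => [[|[|[|//]]]] ?; rewrite /f /g /= ?leIl ?leIr //;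
    exact/negbTE.
pose g (i : 'I_3) := nth \bot [:: y `|` z; x `|` z; x `|` y] i.
apply: (@dismantlable_no_crown _ L g f disL) => i j.
case: i => [[|[|[|//]]]] ?; case: j => [[|[|[|//]]]] ?; rewrite /f /g /= ?leUl ?leUr //;
  exact/negbTE.
Qed.

(** * Two linear extensions from an orientation *)

Section LeftRight.

Variables (d : Order.disp_t) (L : finTBLatticeType d).
Hypotheses (sdL : semidistributive L) (disL : dismantlable L).

(** Sliding along meets forces $xz \le y$ and $xy \le z$, hence $xy = xz$. Then $SD_\wedge$ gives
    $xy = x(y+z)$, so [x] is incomparable to $y+z$, and sliding [y] up to $y+z$ and down to [z] puts
    both on the same side of [x]. *)
Lemma orientation_no_cycle_aux (o : rel L) (x y z : L) :
  orientation predT o -> x >< y -> y >< z -> z >< x ->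
  o x y -> o y z -> o z x -> ~~ (y `&` z <= x).
Proof.
move=> oS xy yz zx oxy oyz ozx; have [anti slide] := oS.
have [yx zy xz] : [/\ y >< x, z >< y & x >< z] by split; rewrite inc_sym.
have slide' u v w : u >< v -> u >< w -> v <= w -> o u v = o u w by apply: slide.
have oyx : o y x = false by rewrite anti // oxy.
have ozy : o z y = false by rewrite anti // oyz.
have oxz : o x z = false by rewrite anti // ozx.
apply/negP=> yzx.
have meet_inc (u v w : L) : u >< v -> ~~ (v `&` w <= u) -> u >< v `&` w.
  rewrite !inc_split => /andP[uv _] ->; rewrite andbT.
  by apply: contra uv => /le_trans; apply; apply: leIl.
case: (boolP (x `&` z <= y)) => xzy; last first.
  have y_zx : y >< z `&` x by apply: meet_inc; rewrite // meetC.
  by move: oyz; rewrite -(slide' y (z `&` x) z) ?leIl // (slide' y _ x) ?leIr // oyx.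
case: (boolP (x `&` y <= z)) => xyz; last first.
  have z_xy : z >< x `&` y by apply: meet_inc.
  by move: ozx; rewrite -(slide' z (x `&` y) x) ?leIl // (slide' z _ y) ?leIr // ozy.
have E : x `&` y = x `&` z.
  by apply/le_anti; rewrite !lexI !leIl xyz xzy.
have E' : x `&` y = x `&` (y `|` z) by apply: (sdL.2 (x `&` y)).
have x_yz : x >< y `|` z.
  move: xy; rewrite !inc_split => /andP[nxy nyx]; apply/andP; split.
    by apply: contra nxy => /meet_l; rewrite -E' => <-; exact: leIr.
  by apply: contra nyx; apply: le_trans; apply: leUl.
by move: oxy; rewrite (slide' x y (y `|` z)) ?leUl // -(slide' x z) ?leUr // oxz.
Qed.

Lemma orientation_no_cycle (o : rel L) (x y z : L) :
  orientation predT o -> x >< y -> y >< z -> z >< x ->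
  o x y -> o y z -> o z x -> False.
Proof.
move=> oS xy yz zx oxy oyz ozx; have [/or3P[] + _] := dismantlable_crown x y z disL.
- exact/negP/(orientation_no_cycle_aux oS).
- by rewrite meetC; apply/negP/(orientation_no_cycle_aux oS yz).
- exact/negP/(orientation_no_cycle_aux oS zx).
Qed.

(** The extension that lists incomparable elements from left to right; the flipped orientation gives
    its companion. *)
Definition before (o : rel L) (x y : L) := (x < y) || (x >< y) && o x y.

(** If one of the two steps is an inequality, the slide property carries the other one over. Two
    steps to the right with incomparable ends would otherwise close a cycle. *)
Lemma before_trans (o : rel L) : orientation predT o -> transitive (before o).
Proof.
move=> oS y x z; have [anti slide] := oS.
have slide' u v w : u >< v -> u >< w -> v <= w -> o u v = o u w by apply: slide.
case/orP=> [xy|/andP[xy oxy]] /orP[yz|/andP[yz oyz]]; rewrite /before.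
- by rewrite (lt_trans xy yz).
- case: (boolP (x >< z)) => [xz|].
    have [zx zy] : z >< x /\ z >< y by split; rewrite inc_sym.
    by rewrite anti // (slide' z x y) ?(ltW xy) // -anti // oyz orbT.
  rewrite negbK /Order.comparable lt_neqAle; case/orP=> [xz|zx].
    rewrite xz andbT; apply/orP; left; apply: contraTneq yz => <-.
    by rewrite inc_split (ltW xy) andbF.
  by move: yz; rewrite inc_split (le_trans zx (ltW xy)) andbF.
- case: (boolP (x >< z)) => [xz|].
    by rewrite -(slide' x y z) ?(ltW yz) // oxy orbT.
  rewrite negbK /Order.comparable lt_neqAle; case/orP=> [xz|zx].
    rewrite xz andbT; apply/orP; left; apply: contraTneq xy => ->.
    by rewrite inc_split (ltW yz) andbF.
  by move: xy; rewrite inc_split (le_trans (ltW yz) zx) andbF.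
- have yx : y >< x by rewrite inc_sym.
  have oyx : o y x = false by rewrite anti // oxy.
  case: (boolP (x >< z)) => [xz|].
    apply/orP; right; rewrite anti //; apply/negP=> ozx.
    by apply: (orientation_no_cycle oS xy yz _ oxy oyz ozx); rewrite inc_sym.
  rewrite negbK => /orP[] h.
    by rewrite -(slide' y x z) // oyx in oyz.
  by rewrite (slide' y z x) // oyx in oyz.
Qed.

Lemma before_irr (o : rel L) : irreflexive (before o).
Proof. by move=> x; rewrite /before ltxx comparablexx. Qed.

Definition rank (o : rel L) (x : L) := #|[set w | before o w x]|.

Lemma rank_before (o : rel L) (x y : L) :
  orientation predT o -> before o x y -> (rank o x < rank o y)%N.
Proof.
move=> oS xy; apply/proper_card/properP; split.
  by apply/subsetP=> w; rewrite !inE => /before_trans; apply.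
by exists x; rewrite inE // before_irr.
Qed.

(** The two linear extensions disagree exactly on incomparable pairs, so the order is their
    intersection. *)
Lemma le_rank (o : rel L) (x y : L) : orientation predT o ->
  (x <= y) = ((rank o x <= rank o y) && (rank (fun u v => o v u) x <= rank (fun u v => o v u) y))%N.
Proof.
move=> oS; have oS' := orientation_flip oS.
apply/idP/idP => [|/andP[r1 r2]].
  rewrite le_eqVlt => /orP[/eqP->|xy]; first by rewrite !leqnn.
  by apply/andP; split; apply/ltnW/rank_before; rewrite // /before xy.
apply: contraT => nxy; case: (boolP (x >< y)) => [xy|].
  have yx : y >< x by rewrite inc_sym.
  case: (boolP (o x y)) => oxy.
    have /(rank_before oS') : before (fun u v => o v u) y x by rewrite /before yx oxy orbT.
    by rewrite ltnNge r2.
  have /(rank_before oS) : before o y x by rewrite /before yx oS.1 // oxy orbT.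
  by rewrite ltnNge r1.
rewrite negbK /Order.comparable (negbTE nxy) => /= yx.
have /(rank_before oS) : before o y x.
  by rewrite /before lt_neqAle yx andbT; apply/orP; left; apply: contraNneq nxy => ->.
by rewrite ltnNge r1.
Qed.

End LeftRight.

Lemma segment_between (R : realType) (p q r : R * R) : segment p q r ->
  exists2 t : R, (0 <= t <= 1)%R &
    r.1 = (p.1 + t * (q.1 - p.1))%R /\ r.2 = (p.2 + t * (q.2 - p.2))%R.
Proof.
case=> t; rewrite /= in_itv /= => t01 <-; exists t => //=.
by rewrite /line_path; split; ring.
Qed.

Section Drawing.

Variables (R : realType) (d : Order.disp_t) (L : finTBLatticeType d).
Hypotheses (sdL : semidistributive L) (disL : dismantlable L).
Variable o : rel L.
Hypothesis oS : orientation predT o.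

Local Open Scope ring_scope.

Let r1 (x : L) : R := (rank o x)%:R.
Let r2 (x : L) : R := (rank (fun u v => o v u) x)%:R.
(** The plane of the two ranks turned by 45 degrees and scaled, so that the product order points
    upwards. *)
Let pos (x : L) : R * R := (r1 x - r2 x, r1 x + r2 x).

Let le_r (x y : L) : (x <= y)%O = (r1 x <= r1 y) && (r2 x <= r2 y).
Proof. by rewrite (le_rank sdL disL x y oS) !ler_nat. Qed.

Let le_r1 (x y : L) : (x <= y)%O -> r1 x <= r1 y.
Proof. by rewrite le_r => /andP[]. Qed.

Let le_r2 (x y : L) : (x <= y)%O -> r2 x <= r2 y.
Proof. by rewrite le_r => /andP[]. Qed.

Let seg_between (x y : L) p : (x <= y)%O -> segment (pos x) (pos y) p ->
  [/\ r1 x *+ 2 <= p.2 + p.1, p.2 + p.1 <= r1 y *+ 2,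
      r2 x *+ 2 <= p.2 - p.1 & p.2 - p.1 <= r2 y *+ 2].
Proof.
move=> xy /segment_between[t /andP[t0 t1] /= [-> ->]].
by have := le_r1 xy; have := le_r2 xy; split; nra.
Qed.

(** If $t > 0$, the first equation forces $s < t$, and then $tC = sD \le tD < tC$. Geometrically,
    two segments that leave a vertex towards incomparable elements are not parallel. *)
Let fork (A B C D s t : R) : 0 <= t -> 0 <= s -> 0 <= A -> 0 <= D ->
  A < B -> D < C -> t * A = s * B -> t * C = s * D -> t = 0.
Proof.
move=> t0 s0 A0 D0 AB DC E1 E2; case: (ltgtP 0 t) t0 => // tp _.
have : s < t by nra.
nra.
Qed.

Let fork_point (x y v : L) (s t : R) : (x <= y)%O -> (x <= v)%O -> (y >< v)%O ->
  0 <= s -> 0 <= t ->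
  t * (r1 y - r1 x) = s * (r1 v - r1 x) -> t * (r2 y - r2 x) = s * (r2 v - r2 x) ->
  t = 0.
Proof.
move=> xy xv; rewrite inc_split !le_r !negb_and -!ltNge => yv s0 t0 E1 E2.
have := le_r1 xy; have := le_r2 xy; have := le_r1 xv; have := le_r2 xv.
move=> a1 a2 a3 a4.
case/andP: yv => /orP[] h1 /orP[] h2.
- lra.
- by apply: (fork t0 s0 _ _ _ _ E2 E1); lra.
- by apply: (fork t0 s0 _ _ _ _ E1 E2); lra.
- lra.
Qed.

Let join_point (y x u : L) (s t : R) : (x <= y)%O -> (u <= y)%O -> (x >< u)%O ->
  0 <= s -> 0 <= t ->
  t * (r1 y - r1 x) = s * (r1 y - r1 u) -> t * (r2 y - r2 x) = s * (r2 y - r2 u) ->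
  t = 0.
Proof.
move=> xy uy; rewrite inc_split !le_r !negb_and -!ltNge => xu s0 t0 E1 E2.
have := le_r1 xy; have := le_r2 xy; have := le_r1 uy; have := le_r2 uy.
move=> a1 a2 a3 a4.
case/andP: xu => /orP[] h1 /orP[] h2.
- lra.
- by apply: (fork t0 s0 _ _ _ _ E1 E2); lra.
- by apply: (fork t0 s0 _ _ _ _ E2 E1); lra.
- lra.
Qed.

Let covby_inc (x y v : L) : covby x y -> covby x v -> y != v -> (y >< v)%O.
Proof.
move=> xy xv yv; rewrite inc_split; apply/andP; split; apply: contra yv => h.
  case: (covby_between xv (ltW (covby_lt xy)) h) => [E|->//].
  by have := covby_lt xy; rewrite E ltxx.
case: (covby_between xy (ltW (covby_lt xv)) h) => [E|->//].
by have := covby_lt xv; rewrite E ltxx.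
Qed.

Let covby_inc_below (y x u : L) : covby x y -> covby u y -> x != u -> (x >< u)%O.
Proof.
move=> xy uy xu; rewrite inc_split; apply/andP; split; apply: contra xu => h.
  case: (covby_between xy h (ltW (covby_lt uy))) => [->//|E].
  by have := covby_lt uy; rewrite E ltxx.
case: (covby_between uy h (ltW (covby_lt xy))) => [->//|E].
by have := covby_lt xy; rewrite E ltxx.
Qed.

Lemma orientation_planar : planar R L.
Proof.
exists pos.
  split=> [x y [E1 E2]|x y xy|x y z xy].
  - apply/le_anti; rewrite !le_r.
    have -> : r1 x = r1 y by lra.
    have -> : r2 x = r2 y by lra.
    by rewrite !lexx.
  - have xy' := ltW (covby_lt xy).
    have : (y <= x)%O = false by apply/lt_geF/covby_lt.
    have := le_r1 xy'; have := le_r2 xy'; rewrite le_r => h2 h1 /negbT.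
    by rewrite negb_and -!ltNge /= => /orP[]; lra.
  - case/(seg_between (ltW (covby_lt xy))) => /= h1 h2 h3 h4.
    by apply: (covby_between xy); rewrite le_r; apply/andP; split; lra.
move=> x y u v xy uv ne' p pxy puv.
have ne : x = u -> y = v -> False by move=> E1 E2; apply: ne'; rewrite E1 E2.
clear ne'.
have lxy := ltW (covby_lt xy); have luv := ltW (covby_lt uv).
have [a1 a2 a3 a4] := seg_between lxy pxy.
have [b1 b2 b3 b4] := seg_between luv puv.
(* Both rank coordinates of the common point lie above those of [x] and [u] and below those of [y]
   and [v]. Hence the join of [x] and [u] is below [y] and [v], and covering makes it an end of each
   edge. *)
have xv : (x <= v)%O by rewrite le_r; apply/andP; split; lra.
have uy : (u <= y)%O by rewrite le_r; apply/andP; split; lra.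
have [t /andP[t0 t1] /= [pt1 pt2]] := segment_between pxy.
have [s /andP[s0 s1] /= [ps1 ps2]] := segment_between puv.
have wy : (x `|` u <= y)%O by rewrite leUx lxy.
have wv : (x `|` u <= v)%O by rewrite leUx xv.
have [Ex|Ey] := covby_between xy (leUl x u) wy; have [Eu|Ev] := covby_between uv (leUr u x) wv.
- have xu : x = u by rewrite -Ex Eu. clear Ex Eu.
  subst u; exists x; rewrite !inE eqxx; split=> //.
  have tz : t = 0.
    have yv : (y >< v)%O by apply: covby_inc xy uv _; apply/eqP=> E; apply: ne.
    by apply: (@fork_point x y v s t) => //; lra.
  rewrite [p]surjective_pairing pt1 pt2 tz /pos; congr (_, _); ring.
- have xv' : x = v by rewrite -Ex Ev. clear Ex Ev.
  subst v; exists x; rewrite !inE eqxx orbT; split=> //.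
  by rewrite [p]surjective_pairing /pos; congr (_, _); lra.
- have yu' : y = u by rewrite -Ey Eu. clear Ey Eu.
  subst u; exists y; rewrite !inE eqxx orbT; split=> //.
  by rewrite [p]surjective_pairing /pos; congr (_, _); lra.
- have yv : y = v by rewrite -Ey Ev. clear Ey Ev.
  subst v; exists y; rewrite !inE eqxx !orbT; split=> //.
  have tz : 1 - t = 0.
    have xu : (x >< u)%O by apply: covby_inc_below xy uv _; apply/eqP=> E; apply: ne.
    by apply: (@join_point y x u (1 - s) (1 - t)) => //; lra.
  rewrite [p]surjective_pairing pt1 pt2; have -> : t = 1 by lra.
  by rewrite /pos; congr (_, _); ring.
Qed.

End Drawing.

Lemma orientable_planar (R : realType) d (L : finTBLatticeType d) :
  semidistributive L -> dismantlable L -> orientable (predT : {pred L}) -> planar R L.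
Proof. by move=> sdL disL [o oS]; apply: orientation_planar oS. Qed.

(** * From drawings to orientations *)

Section CovbyPath.

Variables (d : Order.disp_t) (L : finPOrderType d).

Lemma ex_covby_path (x y : L) :
  x <= y -> exists2 s, path (@covby d L) x s & last x s = y.
Proof.
move: {2}_.+1 (ltnSn #|[set w | x < w]|) => n.
elim: n x => // n IH x; rewrite ltnS => xn.
rewrite le_eqVlt => /orP[/eqP->|xy]; first by exists [::].
have [z xz zy] := ex_covby_above xy.
have [|s zs sy] := IH z _ zy; last by exists (z :: s); rewrite //= xz.
apply: leq_trans xn; apply/proper_card/properP; split.
  by apply/subsetP=> w; rewrite !inE; apply: lt_trans; apply: covby_lt.
by exists z; rewrite !inE ?ltxx // covby_lt.
Qed.

Lemma covby_path_ge (x y : L) s : path (@covby d L) x s -> y \in x :: s -> x <= y.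
Proof.
elim: s x => [|z s IH] x /=; first by rewrite inE => _ /eqP->.
case/andP=> xz zs; rewrite inE => /orP[/eqP->//|/(IH z zs)].
by apply: le_trans; apply/ltW/covby_lt.
Qed.

Lemma covby_path_comparable (x y z : L) s :
  path (@covby d L) x s -> y \in x :: s -> z \in x :: s -> y >=< z.
Proof.
elim: s x => [|w s IH] x; first by rewrite !inE => _ /eqP-> /eqP->; rewrite comparablexx.
move=> xs; rewrite inE => /orP[/eqP->|yw].
  by move/(covby_path_ge xs)=> h; rewrite /Order.comparable h.
rewrite inE => /orP[/eqP->|zw].
  have : y \in x :: w :: s by rewrite inE yw orbT.
  by move/(covby_path_ge xs)=> h; rewrite /Order.comparable h orbT.
by case/andP: xs => _ ws; apply: (IH w).
Qed.

End CovbyPath.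

Section PlanarOrientable.

Variables (R : realType) (d : Order.disp_t) (L : finTBLatticeType d).
Variable pos : L -> R * R.
Hypothesis hasse : hasse_drawing pos.
Hypothesis noncrossing : forall x y u v, covby x y -> covby u v -> (x, y) <> (u, v) ->
  forall p, segment (pos x) (pos y) p -> segment (pos u) (pos v) p ->
  exists w, [/\ w \in [:: x; y], w \in [:: u; v] & p = pos w].

Local Open Scope ring_scope.
Import numFieldNormedType.Exports.

Let H (x : L) : R := (pos x).2.
Let X (x : L) : R := (pos x).1.

Let covby_height (x y : L) : covby x y -> H x < H y.
Proof. by case: hasse => _ + _; apply. Qed.

Definition edge_abscissa (x y : L) (h : R) : R :=
  X x + (h - H x) / (H y - H x) * (X y - X x).

(* The abscissa at height h of the polygonal line drawn for the path x :: s; the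
   truncations make it visibly continuous. *)
Fixpoint path_abscissa (x : L) (s : seq L) (h : R) : R :=
  if s is y :: s' then
    edge_abscissa x y (Num.min h (H y)) + (path_abscissa y s' (Num.max h (H y)) - X y)
  else X x.

Lemma edge_abscissa_left (x y : L) : edge_abscissa x y (H x) = X x.
Proof. by rewrite /edge_abscissa subrr !mul0r addr0. Qed.

Lemma edge_abscissa_right (x y : L) : covby x y -> edge_abscissa x y (H y) = X y.
Proof.
move/covby_height=> h; rewrite /edge_abscissa divff ?mul1r; last by rewrite subr_eq0 gt_eqF.
by rewrite addrC subrK.
Qed.

Lemma edge_segment (x y : L) h : covby x y -> H x <= h <= H y ->
  segment (pos x) (pos y) (edge_abscissa x y h, h).
Proof.
move=> xy /andP[xh hy]; have lt_xy := covby_height xy.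
have nz : H y - H x != 0 by rewrite subr_eq0 gt_eqF.
exists ((h - H x) / (H y - H x)).
  rewrite /= in_itv /= ler_pdivlMr ?ler_pdivrMr ?subr_gt0 // mul0r mul1r.
  by rewrite subr_ge0 lerD2r xh hy.
rewrite /line_path /edge_abscissa -/(H x) -/(H y) -/(X x) -/(X y); congr (_, _); first by ring.
by field.
Qed.

Lemma path_abscissa_start (x : L) s : path (@covby d L) x s ->
  path_abscissa x s (H x) = X x.
Proof.
elim: s x => //= y s IH x /andP[xy ys]; have lt_xy := covby_height xy.
by rewrite min_l ?max_r ?(ltW lt_xy) // IH // subrr addr0 edge_abscissa_left.
Qed.

Lemma path_abscissa_head (x y : L) s h : path (@covby d L) x (y :: s) -> h <= H y ->
  path_abscissa x (y :: s) h = edge_abscissa x y h.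
Proof.
move=> /= /andP[xy ys] hy.
by rewrite min_l ?max_r // path_abscissa_start // subrr addr0.
Qed.

Lemma path_abscissa_tail (x y : L) s h : path (@covby d L) x (y :: s) -> H y <= h ->
  path_abscissa x (y :: s) h = path_abscissa y s h.
Proof.
move=> /= /andP[xy ys] hy.
by rewrite min_r ?max_l // edge_abscissa_right // addrC subrK.
Qed.

Lemma path_abscissa_continuous (x : L) s : continuous (path_abscissa x s).
Proof.
elim: s x => [|y s IH] x h; first exact: cvg_cst.
have cid : {for h, continuous (fun r : R => r)} by exact: cvg_id.
have ccst (c : R) : {for h, continuous (fun r : R => c)} by exact: cvg_cst.
have cmax : {for h, continuous (fun r => Num.max r (H y))}.
  exact: (continuous_max cid (ccst _)).
have cmin : {for h, continuous (fun r => Num.min r (H y))}.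
  exact: (continuous_min cid (ccst _)).
apply: cvgD.
  apply: cvgD; first exact: cvg_cst.
  apply: cvgM; last exact: cvg_cst.
  apply: cvgM; last exact: cvg_cst.
  by apply: cvgB; [exact: cmin | exact: cvg_cst].
apply: cvgB; last exact: cvg_cst.
exact: (continuous_comp cmax (IH y _)).
Qed.

Lemma height_lt (x y : L) : (x < y)%O -> H x < H y.
Proof.
move=> xy; have [z xz zy] := ex_covby_above xy.
have [s] := ex_covby_path zy; move=> zs <- {xy zy}.
elim: s z xz zs => [|w s IH] z xz /=; first by move=> _; apply: covby_height.
case/andP=> zw ws; apply: (lt_trans (covby_height xz)).
by elim: s z w zw ws {IH xz} => [|t s IH] z w zw /=; [move=> _; exact: covby_height
  | case/andP=> wt ts; apply: (lt_trans (covby_height zw)); exact: IH wt ts].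
Qed.

Lemma height_le (x y : L) : (x <= y)%O -> H x <= H y.
Proof. by rewrite le_eqVlt => /orP[/eqP->//|/height_lt/ltW]. Qed.

Lemma comparable_height (x y : L) : (x >=< y)%O -> H x <= H y -> (x <= y)%O.
Proof.
case/orP=> // yx hxy; case: (eqVneq y x) yx => [->//|yx lyx].
by have : H y < H x by [rewrite height_lt // lt_neqAle yx]; rewrite ltNge hxy.
Qed.

(** Two vertices of the path of which one covers the other are consecutive on it. *)
Lemma path_abscissa_edge (x u v : L) s h : path (@covby d L) x s ->
  u \in x :: s -> v \in x :: s -> covby u v -> H u <= h <= H v ->
  path_abscissa x s h = edge_abscissa u v h.
Proof.
elim: s x => [|y s IH] x xs.
  by rewrite !inE => /eqP-> /eqP-> /covby_lt; rewrite ltxx.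
have /andP[xy ys] := xs.
rewrite inE => /orP[/eqP->|uy] vxy uv /andP[uh hv].
  have vy : v = y.
    move: vxy; rewrite inE => /orP[/eqP E|/(covby_path_ge ys) yv].
      by have := covby_lt uv; rewrite E ltxx.
    case: (covby_between uv (ltW (covby_lt xy)) yv) => // E.
    by have := covby_lt xy; rewrite E ltxx.
  by rewrite path_abscissa_head // -?vy.
have yu := covby_path_ge ys uy.
rewrite path_abscissa_tail ?(le_trans (height_le yu)) //.
apply: IH => //; last by rewrite uh.
move: vxy; rewrite inE => /orP[/eqP E|//].
have := lt_le_trans (covby_lt xy) (le_trans yu (ltW (covby_lt uv))).
by rewrite E ltxx.
Qed.

Lemma path_abscissa_vertex (x u : L) s : path (@covby d L) x s ->
  u \in x :: s -> path_abscissa x s (H u) = X u.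
Proof.
elim: s x => [|y s IH] x xs; first by rewrite inE => /eqP->.
rewrite inE => /orP[/eqP->|uy]; first exact: path_abscissa_start.
have /andP[xy ys] := xs.
by rewrite path_abscissa_tail ?IH // height_le ?(covby_path_ge ys).
Qed.

Lemma path_find_edge (x y : L) s h : path (@covby d L) x (y :: s) ->
  H x <= h <= H (last y s) -> exists u v,
  [/\ u \in [:: x, y & s], v \in [:: x, y & s], covby u v & H u <= h <= H v].
Proof.
elim: s x y => [|z s IH] x y xys /andP[xh hl]; have /andP[xy ys] := xys.
  by exists x, y; rewrite !inE !eqxx orbT xh.
case: (leP h (H y)) => hy.
  by exists x, y; rewrite !inE !eqxx orbT xh.
have [|u [v [us vs uv huv]]] := IH y z ys; first by rewrite ltW.
by exists u, v; rewrite inE us orbT inE vs orbT.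
Qed.

(** A maximal chain of L, listed without its bottom element. *)
Definition spans (s : seq L) := path (@covby d L) \bot s && (last \bot s == \top).

Lemma ex_spans (x y : L) : (x <= y)%O ->
  exists2 s, spans s & (x \in \bot :: s) && (y \in \bot :: s).
Proof.
move=> xy; have [s1 p1 l1] := ex_covby_path (le0x x).
have [s2 p2 l2] := ex_covby_path xy; have [s3 p3 l3] := ex_covby_path (lex1 y).
exists (s1 ++ s2 ++ s3).
  by rewrite /spans !cat_path !last_cat p1 l1 p2 l2 p3 l3 eqxx.
have x1 : x \in \bot :: s1 by rewrite -l1 mem_last.
have memx z : z \in \bot :: s1 -> z \in \bot :: s1 ++ s2 ++ s3.
  by rewrite -cat_cons mem_cat => ->.
rewrite memx //=; have : y \in x :: s2 by rewrite -l2 mem_last.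
rewrite inE => /orP[/eqP->|ys2]; first exact: memx.
by rewrite inE !mem_cat ys2 !orbT.
Qed.

(** The difference of the two abscissas is continuous and changes sign, so it vanishes at some
    height between [h] and [k]. There an edge of one chain meets an edge of the other, and in a
    noncrossing drawing distinct edges meet only at a common vertex. *)
Lemma spans_cross (s t : seq L) (h k : R) : spans s -> spans t ->
  H \bot <= h <= H \top -> H \bot <= k <= H \top ->
  (path_abscissa \bot s h - path_abscissa \bot t h) *
  (path_abscissa \bot s k - path_abscissa \bot t k) < 0 ->
  exists w, [/\ w \in \bot :: s, w \in \bot :: t & Num.min h k <= H w <= Num.max h k].
Proof.
wlog hk : h k / h <= k.
  move=> W ss tt hh kk; case: (leP h k) => hk fk.
    by have := W h k hk ss tt hh kk fk; rewrite min_l ?max_r.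
  by have := W k h (ltW hk) ss tt kk hh; rewrite mulrC min_l ?max_r ?ltW //; apply.
move=> /andP[ps /eqP ls] /andP[pt /eqP lt] /andP[h0 h1] /andP[k0 k1].
rewrite min_l // max_r //.
pose f (r : R) : R := path_abscissa \bot s r - path_abscissa \bot t r.
rewrite -/(f h) -/(f k) => fhk.
have fc : continuous f.
  by move=> r; apply: cvgB; apply: path_abscissa_continuous.
have [|r] := @IVT R f h k 0 hk (continuous_subspaceT fc).
  rewrite ge_min le_max; case: (ltP (f h) 0) fhk => fh fhk.
    by rewrite (ltW fh) /=; nra.
  by rewrite andbT; apply/orP; right; nra.
rewrite in_itv /= => /andP[hr rk] fr.
have edge w : path (@covby d L) \bot w -> last \bot w = \top -> exists u v,
    [/\ u \in \bot :: w, v \in \bot :: w, covby u v & H u <= r <= H v].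
  move=> pw lw; case: w pw lw => [|y w] pw lw; last first.
    move: lw => /= lw; apply: path_find_edge pw _.
    by rewrite lw (le_trans h0 hr) (le_trans rk k1).
  (* A chain without edges means that bottom and top agree; then so do the heights, and a square
     would be negative. *)
  have hk' : h = k.
    by apply/le_anti; rewrite hk /=; move: k1 h0; rewrite -lw /=; apply: le_trans.
  by move: fhk; rewrite hk'; nra.
have [u [v [us vs uv ruv]]] := edge s ps ls.
have [u' [v' [us' vs' uv' ruv']]] := edge t pt lt.
have sE := path_abscissa_edge ps us vs uv ruv.
have tE := path_abscissa_edge pt us' vs' uv' ruv'.
have E : edge_abscissa u v r = edge_abscissa u' v' r.
  by apply/eqP; rewrite -sE -tE -subr_eq0; apply/eqP.
(* On a shared edge the lower end is the required vertex unless it is below [h]; in that case the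
   shared edge reaches height [h], where the difference would be zero. *)
case: (eqVneq (u, v) (u', v')) => [[Eu Ev]|/eqP ne].
  subst u' v'; case: (leP h (H u)) => hu.
    by exists u; split=> //; rewrite hu; case/andP: ruv => /le_trans->.
  case/andP: ruv => _ rv; have hv : H u <= h <= H v by rewrite ltW // (le_trans hr).
  move: fhk; rewrite /f (path_abscissa_edge ps us vs uv hv).
  by rewrite (path_abscissa_edge pt us' vs' uv hv) subrr mul0r ltxx.
have segr := edge_segment uv ruv; have segr' := edge_segment uv' ruv'.
rewrite -E in segr'.
have [w [wuv wuv' Ew]] := noncrossing uv uv' ne segr segr'.
exists w; split.
- by move: wuv; rewrite !inE => /orP[]/eqP->.
- by move: wuv'; rewrite !inE => /orP[]/eqP->.
- by rewrite /H -Ew /= hr rk.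
Qed.

(** Sides are read off one chosen maximal chain [C x] through each [x]: [D s y] is the signed
    horizontal distance from the chain [s] to [y], and the relation holds when [y] is to the left of
    [C x]. This mirrors the usual convention, which is harmless because orientations can be
    flipped. *)
Lemma planar_orientation : orientable (predT : {pred L}).
Proof.
have ex_span x : exists s, spans s && (x \in \bot :: s).
  by have [s ss /andP[xs _]] := ex_spans (lexx x); exists s; rewrite ss.
pose C x := xchoose (ex_span x).
have [Cspan Cx] : (forall x, spans (C x)) /\ (forall x, x \in \bot :: C x).
  by split=> x; have /andP[] := xchooseP (ex_span x).
have spath s : spans s -> path (@covby d L) \bot s by case/andP.
pose D s (x : L) := X x - path_abscissa \bot s (H x).
have bounds x : H \bot <= H x <= H \top by rewrite !height_le ?le0x ?lex1.
have D0 s x y : spans s -> x \in \bot :: s -> (x >< y)%O -> D s y != 0.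
  move=> ss xs xy; apply/eqP=> /eqP; rewrite subr_eq0 => /eqP E.
  have ns z : z \in \bot :: s -> z != y.
    move=> zs; apply: contraNneq xy => zy.
    by rewrite -zy (covby_path_comparable (spath _ ss)).
  case: s ss xs E ns => [|z s] ss xs E ns.
    move: ss; rewrite /spans /= => /eqP bt.
    move: (ns \bot); rewrite inE eqxx => /(_ isT)/eqP; apply.
    by apply/le_anti; rewrite le0x bt lex1.
  have [|u [v [us vs uv huv]]] := path_find_edge (h := H y) (spath _ ss).
    by case/andP: ss => _ /= /eqP->.
  have [_ _ avoid] := hasse.
  have := path_abscissa_edge (spath _ ss) us vs uv huv.
  rewrite -E => Ey; have := edge_segment uv huv.
  rewrite -Ey -surjective_pairing => /(avoid _ _ _ uv)[] yE.
    by move: (ns _ us); rewrite yE eqxx.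
  by move: (ns _ vs); rewrite yE eqxx.
have slide x y z : (x >< y)%O -> (x >< z)%O -> (y <= z)%O ->
    (D (C x) y < 0) = (D (C x) z < 0).
  move=> xy xz yz; have Dy := D0 _ _ _ (Cspan x) (Cx x) xy.
  have Dz := D0 _ _ _ (Cspan x) (Cx x) xz.
  have [t tt /andP[yt zt]] := ex_spans yz.
  (* A chain through [y] and [z] that changes sides of [C x] shares with it a vertex between [y] and
     [z]; this vertex is comparable to [x], which makes [x] comparable to [y] or [z]. *)
  have nocross : ~~ (D (C x) y * D (C x) z < 0).
    rewrite /D -(path_abscissa_vertex (spath _ tt) yt) -(path_abscissa_vertex (spath _ tt) zt).
    apply/negP=> /(spans_cross tt (Cspan x) (bounds y) (bounds z))[w [wt wx]].
    have hyz := height_le yz; rewrite min_l // max_r // => /andP[yw wz].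
    have cwy := covby_path_comparable (spath _ tt) wt yt.
    have cwz := covby_path_comparable (spath _ tt) wt zt.
    have cwx := covby_path_comparable (spath _ (Cspan x)) wx (Cx x).
    have lwz := comparable_height cwz wz.
    have lyw : (y <= w)%O by apply: comparable_height yw; rewrite comparable_sym.
    move: xy xz; rewrite !inc_split => /andP[_ nyx] /andP[nxz _].
    case/orP: cwx => h; first by rewrite (le_trans lyw h) in nyx.
    by rewrite (le_trans h lwz) in nxz.
  move: nocross; rewrite -leNgt.
  by case: (ltgtP (D (C x) y) 0) Dy => // Dy _; case: (ltgtP (D (C x) z) 0) Dz => // Dz _; nra.
have anti x y : (x >< y)%O -> (D (C x) y < 0) = ~~ (D (C y) x < 0).
  move=> xy; have yx : (y >< x)%O by rewrite inc_sym.
  have Dy := D0 _ _ _ (Cspan x) (Cx x) xy; have Dx := D0 _ _ _ (Cspan y) (Cx y) yx.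
  (* Otherwise [C x] and [C y] share a vertex whose height is between those of [x] and [y]. It is
     not strictly above both nor strictly below both, so it links [x] and [y] in the order. *)
  have nocross : ~~ (0 < D (C x) y * D (C y) x).
    apply/negP=> Dxy.
    have : (path_abscissa \bot (C x) (H x) - path_abscissa \bot (C y) (H x)) *
           (path_abscissa \bot (C x) (H y) - path_abscissa \bot (C y) (H y)) < 0.
      rewrite (path_abscissa_vertex (spath _ (Cspan x)) (Cx x)).
      rewrite (path_abscissa_vertex (spath _ (Cspan y)) (Cx y)).
      by move: Dxy; rewrite /D; nra.
    move/(spans_cross (Cspan x) (Cspan y) (bounds x) (bounds y))=> [w [wx wy]].
    have cwx := covby_path_comparable (spath _ (Cspan x)) wx (Cx x).
    have cwy := covby_path_comparable (spath _ (Cspan y)) wy (Cx y).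
    move: xy; rewrite inc_split => /andP[nxy nyx].
    have nwx : w != x.
      by apply: contraNneq nxy => wx'; move: cwy; rewrite wx' => /orP[//|h]; rewrite h in nyx.
    have nwy : w != y.
      by apply: contraNneq nxy => wy'; move: cwx; rewrite wy' => /orP[h|//]; rewrite h in nyx.
    move=> /andP[lo hi]; case/orP: cwx => hx; case/orP: cwy => hy.
    - have h1 : H w < H x by rewrite height_lt // lt_neqAle nwx.
      have h2 : H w < H y by rewrite height_lt // lt_neqAle nwy.
      by move: lo; rewrite leNgt lt_min h1 h2.
    - by rewrite (le_trans hy hx) in nyx.
    - by rewrite (le_trans hx hy) in nxy.
    - have h1 : H x < H w by rewrite height_lt // lt_neqAle eq_sym nwx.
      have h2 : H y < H w by rewrite height_lt // lt_neqAle eq_sym nwy.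
      by move: hi; rewrite leNgt gt_max h1 h2.
  move: nocross; rewrite -leNgt.
  by case: (ltgtP (D (C x) y) 0) Dy => // Dy' _; case: (ltgtP (D (C y) x) 0) Dx => // Dx' _; nra.
exists (fun x y => D (C x) y < 0); split=> [x y _ _|x y z _ _ _]; first exact: anti.
exact: slide.
Qed.

End PlanarOrientable.

Lemma planar_orientable (R : realType) d (L : finTBLatticeType d) :
  planar R L -> orientable (predT : {pred L}).
Proof. by case=> pos hasse noncrossing; apply: planar_orientation hasse noncrossing. Qed.

(** * Sublattices and the minimal family *)

Lemma lmorphism_of d (K : latticeType d) d' (L : latticeType d') (f : K -> L) :
  {morph f : x y / x `&` y} -> {morph f : x y / x `|` y} ->
  exists g : {lmorphism K -> L}, g =1 f.
Proof.
move=> fI fU.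
have fle : {homo f : x y / x <= y}.
  by move=> x y /meet_idPl xy; apply/meet_idPl; rewrite -fI xy.
pose g0 : {omorphism K -> L} := HB.pack f (Order.isOrderMorphism.Build d K d' L f fle).
pose g : {lmorphism K -> L} :=
  HB.pack (Order.OrderMorphism.sort g0) (Order.isLatticeMorphism.Build d K d' L g0 fI fU).
by exists g.
Qed.

Section SubLattice.

Variables (d : Order.disp_t) (L : finTBLatticeType d) (S : {set L}) (x0 : L).
Hypotheses (mS : meet_closed (mem S)) (jS : join_closed (mem S)) (x0S : x0 \in S).

(** The proofs are arguments of the type so that the instances declared on it, including its own
    bounds, can be built from them. *)
Definition sub_lattice of x0 \in S & meet_closed (mem S) & join_closed (mem S) : Type :=
  {x : L | x \in S}.

Local Notation K := (sub_lattice x0S mS jS).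

HB.instance Definition _ := SubFinite.copy K {x : L | x \in S}.
HB.instance Definition _ := Order.SubChoice_isSubLattice.Build d L (mem S) d K mS jS.

(** The iterated meet starts from the top of L, which may lie outside [S]; an additional meet with
    [x0] changes nothing and keeps every partial result in [S]. *)
Lemma sub_lattice_meet : \meet_(x in S) x \in S.
Proof.
have <- : x0 `&` \meet_(x in S) x = \meet_(x in S) x by apply/meet_r/meets_inf.
elim/big_rec: _ => [|x y xS yS]; first by rewrite meetx1.
by rewrite meetCA mS.
Qed.

Lemma sub_lattice_join : \join_(x in S) x \in S.
Proof.
have <- : x0 `|` \join_(x in S) x = \join_(x in S) x by apply/join_r/joins_sup.
elim/big_rec: _ => [|x y xS yS]; first by rewrite joinx0.
by rewrite joinCA jS.
Qed.

Lemma sub_lattice_le0x (x : K) : (exist (fun x => x \in S) _ sub_lattice_meet : K) <= x.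
Proof. by rewrite -Order.le_val; apply: (@meets_inf _ _ _ (val x) (mem S) id); exact: valP. Qed.

Lemma sub_lattice_lex1 (x : K) : x <= (exist (fun x => x \in S) _ sub_lattice_join : K).
Proof. by rewrite -Order.le_val; apply: (@joins_sup _ _ _ (val x) (mem S) id); exact: valP. Qed.

HB.instance Definition _ := Order.hasBottom.Build d K sub_lattice_le0x.
HB.instance Definition _ := Order.hasTop.Build d K sub_lattice_lex1.

Definition sub_tblattice : finTBLatticeType d := K.

Lemma sub_lattice_lmorphism :
  exists f : {lmorphism sub_tblattice -> L}, f =1 (val : K -> L).
Proof. by apply: lmorphism_of. Qed.

End SubLattice.

Lemma embeds_trans d1 (K : latticeType d1) d2 (L : latticeType d2) d3 (M : latticeType d3) :
  embeds K L -> embeds L M -> embeds K M.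
Proof.
case=> f fi [g gi]; have [||h hE] := @lmorphism_of _ K _ M (g \o f).
- by move=> x y /=; rewrite !omorphI.
- by move=> x y /=; rewrite !omorphU.
by exists h => x y; rewrite !hE /= => /gi/fi.
Qed.

Section Embedding.

Variables (d : Order.disp_t) (K : finTBLatticeType d).
Variables (d' : Order.disp_t) (L : finTBLatticeType d').
Variable f : {lmorphism K -> L}.
Hypothesis fi : injective f.

Let fI : {morph f : x y / x `&` y}. Proof. exact: omorphI. Qed.
Let fU : {morph f : x y / x `|` y}. Proof. exact: omorphU. Qed.

Lemma embedding_le (x y : K) : (f x <= f y) = (x <= y).
Proof. by rewrite !leEmeet -fI (inj_eq fi). Qed.

Lemma embedding_orientable :
  orientable (predT : {pred L}) -> orientable (predT : {pred K}).
Proof.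
have inc (x y : K) : (f x >< f y) = (x >< y) by rewrite !inc_split !embedding_le.
case=> o [anti slide]; exists (fun x y => o (f x) (f y)); split.
  by move=> x y _ _ xy; apply: anti; rewrite ?inc.
by move=> x y z _ _ _ xy xz yz; apply: slide; rewrite ?inc ?embedding_le.
Qed.

Lemma embedding_semidistributive : semidistributive L -> semidistributive K.
Proof.
case=> sdj sdm; split=> x a b c E1 E2; apply: fi.
  by rewrite fU fI; apply: sdj; rewrite -fU -?E1 -?E2.
by rewrite fI fU; apply: sdm; rewrite -fI -?E1 -?E2.
Qed.

Lemma take_pmap (A B : Type) (p : A -> option B) (s : seq A) k :
  exists j, take k (pmap p s) = pmap p (take j s).
Proof.
elim: s k => [|x s IH] k; first by exists 0%N.
case: k => [|k]; first by exists 0%N; rewrite !take0.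
rewrite /=; case E: (p x) => [b|] /=.
  by have [j Ej] := IH k; exists j.+1; rewrite /= E /= Ej.
by have [j Ej] := IH k.+1; exists j.+1; rewrite /= E /= Ej.
Qed.

(** Discarding from a dismantling sequence of L the elements outside the image leaves one of K: its
    prefixes are preimages of prefixes, hence closed. *)
Lemma embedding_dismantlable : dismantlable L -> dismantlable K.
Proof.
case=> s [us sT closed]; pose p (y : L) := [pick x | f x == y].
have pK : ocancel p f.
  by move=> y; rewrite /p; case: pickP => // x /eqP.
have pf x : p (f x) = Some x.
  rewrite /p; case: pickP => [x' /eqP/fi->//|/(_ x)]; by rewrite eqxx.
have mem_p t x : (x \in pmap p t) = (f x \in t).
  rewrite -(mem_map fi) mem_map //; apply/idP/idP => [|fx].
    rewrite mem_pmap => /mapP[y yt] Ep.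
    by have := pK y; rewrite -Ep /= => ->.
  by rewrite mem_pmap -pf map_f.
exists (pmap p s); split.
- exact: (pmap_uniq pK).
- by move=> x; rewrite mem_p sT.
move=> k /andP[k0 ks]; have [j Ej] := take_pmap p s k; rewrite Ej.
have j0 : (0 < j)%N.
  case: j Ej => // Ej; have := congr1 size Ej.
  by rewrite take0 /= size_take ks => k00; rewrite k00 in k0.
have [mt jt] : meet_closed (mem (take j s)) /\ join_closed (mem (take j s)).
  (* Dismantling speaks of proper prefixes only; the full sequence is all of L and closed anyway. *)
  case: (ltnP j (size s)) => js; first by apply: closed; rewrite j0.
  by rewrite take_oversize //; split=> x y _ _; rewrite sT.
split=> x y; rewrite !mem_p => xt yt.
  by rewrite fI mt.
by rewrite fU jt.
Qed.

End Embedding.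

(** * Minimal nonplanar lattices *)

(** Minimality is phrased by embeddings instead of subsets, which compares lattices on different
    types and makes invariance under isomorphism easy. *)
Definition minimal_nonplanar (R : realType) : lattice_class := fun d L =>
  [/\ dismantlable L, semidistributive L, ~ planar R L &
      forall d' (K : finTBLatticeType d'), ~ planar R K ->
      forall f : {lmorphism K -> L}, injective f -> bijective f].

Lemma minimal_nonplanar_critical (R : realType) d (L : finTBLatticeType d) :
  minimal_nonplanar R L -> critical L.
Proof.
case=> disL sdL npL minL; split=> //.
- by move=> x y z; apply: dismantlable_crown.
- move=> S mS jS ST; case: (set_0Vmem S) => [S0|[x0 x0S]].
    by exists (fun _ _ => true); split=> [x y|x y z] xS; rewrite S0 inE in xS.
  pose K := sub_tblattice mS jS x0S.
  have [f fE] : exists f : {lmorphism K -> L}, f =1 val := sub_lattice_lmorphism mS jS x0S.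
  have fi : injective f by move=> x y; rewrite !fE => /val_inj.
  have /planar_orientable[o [anti slide]] : planar R K.
    apply/not_notP => npK; have [g _ gK] := minL _ K npK _ fi.
    case/eqP: ST; apply/setP=> x; by rewrite inE -[x]gK fE; exact: (valP (g x)).
  (* Outside [S] this takes the default value [x0], which an orientation of [S] never consults. *)
  pose e x : K := insubd (exist _ x0 x0S : {x | x \in S}) x.
  have eK x : x \in S -> f (e x) = x by move=> xS; rewrite fE; apply: insubdK.
  have einc x y : x \in S -> y \in S -> (e x >< e y) = (x >< y).
    by move=> xS yS; rewrite !inc_split -!(embedding_le fi) !eK.
  exists (fun x y => o (e x) (e y)); split=> [x y xS yS xy|x y z xS yS zS xy xz yz].
    by apply: anti; rewrite ?einc.
  by apply: slide; rewrite ?einc // -(embedding_le fi) !eK.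
- by move=> oL; apply: npL; apply: orientable_planar.
Qed.

(** Descent on the cardinality: if L is not minimal, a nonplanar lattice embeds in it without being
    onto, hence is smaller, and it inherits the other hypotheses. *)
Lemma nonplanar_embeds_minimal (R : realType) d (L : finTBLatticeType d) :
  dismantlable L -> semidistributive L -> ~ planar R L ->
  exists d' (K : finTBLatticeType d'), minimal_nonplanar R K /\ embeds K L.
Proof.
move: {2}_.+1 (ltnSn #|L|) => n; elim: n d L => // n IH d L.
rewrite ltnS => Ln disL sdL npL.
case: (EM (minimal_nonplanar R L)) => [minL|nminL].
  exists d, L; split=> //; have [g gE] := @lmorphism_of _ L _ L id (fun _ _ => erefl) (fun _ _ => erefl).
  by exists g => x y; rewrite !gE.
have [d' [K [npK [f fi nbij]]]] : exists d' (K : finTBLatticeType d'),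
    ~ planar R K /\ exists2 f : {lmorphism K -> L}, injective f & ~ bijective f.
  apply: contra_notP nminL => none; split=> // d' K npK f fi.
  by apply: contra_notP none => nbij; exists d', K; split=> //; exists f.
have KL : (#|K| < #|L|)%N.
  by rewrite ltnNge; apply/negP=> LK; apply: nbij; apply: inj_card_bij.
have [d2 [M [minM MK]]] := IH d' K (leq_trans KL Ln)
  (embedding_dismantlable fi disL) (embedding_semidistributive fi sdL) npK.
by exists d2, M; split=> //; apply: embeds_trans MK _; exists f.
Qed.

(** Planarity passes to sublattices through orientability. If a subclass [G] also characterizes
    planarity, a minimal nonplanar L contains a member of [G]; this member is nonplanar, so its
    embedding is onto and L itself is in [G]. *)
Lemma minimal_nonplanar_family (R : realType) :
  minimal_forbidden_family R (minimal_nonplanar R).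
Proof.
have hered d (K : finTBLatticeType d) d' (L : finTBLatticeType d') :
    dismantlable L -> semidistributive L -> embeds K L -> planar R L -> planar R K.
  move=> disL sdL [f fi] /planar_orientable oL; apply: orientable_planar.
  - exact: (embedding_semidistributive fi sdL).
  - exact: (embedding_dismantlable fi disL).
  - exact: (embedding_orientable fi oL).
have chara : characterizes_planarity R (minimal_nonplanar R).
  move=> d L disL sdL; split=> [plL [d' [K [[_ _ npK _] KL]]]|].
    by apply: npK; apply: hered KL plL.
  by move=> none; apply: contra_notP none; apply: nonplanar_embeds_minimal.
split=> //.
- move=> d K d' L [f fb] [disK sdK npK minK]; have [g fK gK] := fb.
  have fi := bij_inj fb.
  have fI : {morph f : x y / x `&` y} by exact: omorphI.
  have fU : {morph f : x y / x `|` y} by exact: omorphU.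
  have [||h hE] := @lmorphism_of _ L _ K g.
  + by move=> x y; apply: fi; rewrite fI !gK.
  + by move=> x y; apply: fi; rewrite fU !gK.
  have hi : injective h by move=> x y; rewrite !hE => /(can_inj gK).
  have disL := embedding_dismantlable hi disK.
  have sdL := embedding_semidistributive hi sdK.
  split=> //; first by move=> plL; apply: npK; apply: hered plL => //; exists f.
  move=> d2 M npM k ki.
  have [k' k'i] : embeds M K.
    by apply: embeds_trans (ex_intro _ h hi); exists k.
  have LM : (#|L| <= #|M|)%N.
    by rewrite -(bij_eq_card fb) (bij_eq_card (minK _ M npM k' k'i)).
  exact: inj_card_bij.
- by move=> d L [].
- move=> G isoG GF charG d L minL; have [disL sdL npL mL] := minL.
  have [d' [K [GK [f fi]]]] : exists d' (K : finTBLatticeType d'), G d' K /\ embeds K L.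
    by apply: contra_notP npL => /(charG d L disL sdL).
  have [_ _ npK _] := GF _ _ GK.
  by apply: isoG GK; exists f; apply: mL.
Qed.

Theorem proposition1 (R : realType) :
  exists F : lattice_class,
    minimal_forbidden_family R F /\
    forall (disp : Order.disp_t) (L : finTBLatticeType disp), F disp L ->
      exists a b c d : L,
        [/\ a != b /\ c != d,
            covby a \top /\ covby b \top,
            covby \bot c /\ covby \bot d,
            c `|` d < a `&` b &
            exists a' b' c' d' : L,
              [/\ a' != a `&` b /\ covby a' a,
                  b' != a `&` b /\ covby b' b,
                  c' != c `|` d /\ covby c c',
                  d' != c `|` d /\ covby d d' &
                  #|[set a'; b'; c'; d']| = 4 \/
                  [/\ #|[set a'; b'; c'; d']| = 3, a' != b' & c' != d']]].
Proof.
exists (minimal_nonplanar R); split; first exact: minimal_nonplanar_family.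
by move=> disp L /minimal_nonplanar_critical/critical_covers.
Qed.
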